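(* Let $n$ be a positive integer and $\mathbf b=(b_1,\dots,b_n)\in\mathbb Z_{>0}^n$, not with $n=1=b_1$. The $h$-polynomial of $\mathfrak X_n(\mathbf b)$ is $$h(\mathfrak X_n(\mathbf b);z)=\begin{cases}\widetilde A_n(z)-n\,z\,A_{n-1}(z)&\text{if }b_1=1,\\ \widetilde A_n(z)&\text{if }b_1\ge 2.\end{cases}$$
   Context: A $\mathbf b$-parking function is a list $(\beta_1,\dots,\beta_n)$ of positive integers whose nondecreasing rearrangement $\beta'_1\le\cdots\le\beta'_n$ satisfies $\beta'_i\le b_1+\cdots+b_i$ for all $i$. The $\mathbf b$-parking-function polytope $\mathfrak X_n(\mathbf b)\subset\mathbb R^n$ is the convex hull of all $\mathbf b$-parking functions. For an $n$-dimensional polytope $P$, $f_i(P)$ denotes the number of $i$-dimensional faces ($0\le i\le n$, so $f_n(P)=1$), $f(P;t)=\sum_{i=0}^n f_i(P)t^i$, and the $h$-polynomial is $h(P;t)=f(P;t-1)$. For $k\ge1$, $A_k(z)=\sum_{\sigma\in\mathfrak S_k}z^{\mathrm{des}(\sigma)}$ is the Eulerian polynomial, where $\mathrm{des}(\sigma)=|\{i:1\le i\le k-1,\ \sigma(i)>\sigma(i+1)\}|$, and $\widetilde A_n(z)=1+z\sum_{k=1}^n\binom nk A_k(z)$ is the binomial Eulerian polynomial. *)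

(* Defs.v *)
From HB Require Import structures.
From mathcomp Require Import all_boot all_order all_fingroup all_algebra finmap.
From mathcomp Require Import boolp classical_sets functions cardinality.
From mathcomp Require Import interval_inference reals convex.

Set Implicit Arguments.
Unset Strict Implicit.
Unset Printing Implicit Defensive.

Import Order.TTheory GRing.Theory Num.Theory.

Local Open Scope classical_set_scope.
Local Open Scope ring_scope.

Section Polytopes.
Variables (R : realType) (n : nat).
Implicit Types P F S : set 'rV[R]_n.

Definition convex_hull S : set 'rV[R]_n :=
  smallest (fun A : set 'rV[R]_n => convex_set A) S.

Definition affine_hull S : set 'rV[R]_n :=
  [set x | exists (m : nat) (c : 'I_m -> R) (p : 'I_m -> 'rV[R]_n),
     [/\ forall i, S (p i), \sum_i c i = 1 & x = \sum_i c i *: p i]].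

(* [has_dim S d] never holds when S is empty, so the empty face, which is a
   face in the sense of [is_face], is not counted in any f_vec P i. *)
Definition has_dim S (d : nat) : Prop :=
  exists (x : 'rV[R]_n) (U : {vspace 'rV[R]_n}),
    affine_hull S = [set x + u | u in [set` U]] /\ \dim U = d.

Definition dotv (c x : 'rV[R]_n) : R := \sum_i c ord0 i * x ord0 i.

(* Taking c = 0 gives the improper faces P (a = 0) and set0 (a = 1). *)
Definition is_face P F : Prop :=
  exists (c : 'rV[R]_n) (a : R),
    (forall x, P x -> dotv c x <= a) /\ F = P `&` [set x | dotv c x = a].

(* fset_set is empty on an infinite set; a polytope has finitely many faces. *)
Definition f_vec P (i : nat) : nat :=
  #|` fset_set [set F | is_face P F /\ has_dim F i]|%fset.

Definition f_poly P : {poly int} := \poly_(i < n.+1) (f_vec P i)%:Z.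

Definition h_poly P : {poly int} := f_poly P \Po ('X - 1).

End Polytopes.

Definition is_parking_function n (b beta : n.-tuple nat) : Prop :=
  (forall i : 'I_n, (0 < tnth beta i)%N) /\
  (forall i : 'I_n, (nth 0 (sort leq beta) i <= \sum_(j < n | j <= i) tnth b j)%N).

Definition parking_polytope (R : realType) n (b : n.-tuple nat) : set 'rV[R]_n :=
  convex_hull [set x | exists2 beta : n.-tuple nat,
    is_parking_function b beta & x = \row_i (tnth beta i)%:R].

Arguments parking_polytope R [n] b.

Definition des k (s : 'S_k) : nat :=
  #|[pred i : 'I_k | [exists j : 'I_k, (j == i.+1 :> nat) && (s j < s i)%N]]|.

Definition eulerian k : {poly int} := \sum_(s : 'S_k) 'X^(des s).

Definition binomial_eulerian n : {poly int} :=
  1 + 'X * \sum_(1 <= k < n.+1) eulerian k *+ 'C(n, k).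

(* Main.v *)
(* For a direction c, the maximum of c over the polytope is attained by giving
   the value 1 to the set N of coordinates where c is negative and, along the
   superlevel sets {c >= r} with r > 0 (a chain C of nonempty subsets of the
   complement of N), the largest available bounds to the coordinates where
   c is largest. So the faces are
     face N C = {x | x_i = 1 for i in N, x(S) = g(#|S|) for S in C},
   with g(k) the sum of the k largest partial sums of b, and face N C has
   dimension n - #|N| - #|C|. Distinct pairs give distinct faces if b_1 > 1; if
   b_1 = 1, the pairs with N empty and C containing the complement S of some i
   are redundant, since x(S) = g(n-1) then forces x_i = 1.
   Summing (z-1)^dim, both the chains of proper nonempty subsets of an m-set and
   the Eulerian polynomial A_m(z) satisfy
     a_m = sum_(k < m) 'C(m, k) (z-1)^(m-k-1) a_k;
   for A_m, z^des is expanded over the decreasing prefixes of a permutation. *)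
Require Import Defs.
From mathcomp Require Import all_boot all_order all_fingroup all_algebra finmap.
From mathcomp Require Import boolp classical_sets functions cardinality.
From mathcomp Require Import interval_inference reals convex.
From mathcomp Require Import ring lra zify fintype finset.

Set Implicit Arguments.
Unset Strict Implicit.
Unset Printing Implicit Defensive.

Import Order.TTheory GRing.Theory Num.Theory.

(** * Chains of subsets *)

Section Chains.
Variable T : finType.
Implicit Types (A B M S : {set T}) (C : {set {set T}}).

Definition chain C := [forall A in C, forall B in C, (A \subset B) || (B \subset A)].

Lemma chainP C :
  reflect {in C &, forall A B, (A \subset B) || (B \subset A)} (chain C).
Proof.
apply: (iffP forall_inP) => [h A B hA hB | h A hA].
  exact: (forall_inP (h A hA)).
by apply/forall_inP => B; apply: h.
Qed.

Lemma chain_sub C C' : C' \subset C -> chain C -> chain C'.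
Proof.
move=> /subsetP sC /chainP cC; apply/chainP => A B /sC hA /sC hB; exact: cC.
Qed.

Lemma chain_card_inj C : chain C -> {in C &, injective (fun A => #|A|)}.
Proof.
move=> /chainP cC A B hA hB eqAB; apply/eqP.
by case/orP: (cC A B hA hB) => sAB; [|rewrite eq_sym]; rewrite eqEcard sAB eqAB leqnn.
Qed.

Lemma chainU1 S C : (forall A, A \in C -> A \subset S) -> chain C -> chain (S |: C).
Proof.
move=> sCS /chainP cC; apply/chainP => A B /setU1P[->|hA] /setU1P[->|hB].
- by rewrite subxx.
- by rewrite (sCS B hB) orbT.
- by rewrite (sCS A hA).
- exact: cC.
Qed.

Definition flags M :=
  [set C | chain C && [forall A in C, (A != set0) && (A \subset M)]].

Definition proper_flags M := [set C in flags M | M \notin C].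

Lemma flagsP M C :
  reflect (chain C /\ forall A, A \in C -> A != set0 /\ A \subset M) (C \in flags M).
Proof.
rewrite inE; apply: (iffP andP) => -[cC h]; split => //.
  by move=> A hA; apply/andP; move/forall_inP: h; apply.
by apply/forall_inP => A hA; apply/andP/h.
Qed.

(** Members of a chain have distinct sizes, here all between 1 and [#|M|]. *)
Lemma flags_card M C : C \in flags M -> #|C| <= #|M|.
Proof.
case/flagsP => cC hC.
have u : uniq [seq #|A| | A : {set T} <- enum C].
  rewrite map_inj_in_uniq ?enum_uniq // => A B; rewrite !mem_enum.
  exact: chain_card_inj.
have := uniq_leq_size (s2 := iota 1 #|M|) u.
rewrite size_map size_iota -cardE; apply => _ /mapP[A hA ->].
have [A0 AM] : A != set0 /\ A \subset M by apply: hC; rewrite mem_enum in hA.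
by rewrite mem_iota add1n ltnS subset_leq_card // card_gt0 A0.
Qed.

Lemma proper_flags_card M C : M != set0 -> C \in proper_flags M -> #|C| < #|M|.
Proof.
move=> M0; rewrite inE => /andP[/flagsP[cC hC] MC].
have /flags_card : M |: C \in flags M.
  apply/flagsP; split; first by apply: chainU1 => // A /hC[].
  by move=> A /setU1P[->|/hC].
by rewrite cardsU1 MC.
Qed.

(** A member of largest size contains all the others, so it is the union. *)
Lemma chain_cover C : chain C -> C != set0 -> cover C \in C.
Proof.
move=> /chainP cC /set0Pn[A0 A0C].
case: (arg_maxnP (fun A => #|A|) A0C) => A hA maxA.
suff -> : cover C = A by [].
apply/eqP; rewrite eqEsubset (bigcup_sup A) // andbT.
apply/bigcupsP => B hB; case/orP: (cC A B hA hB) => // sAB.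
suff -> : A = B by [].
by apply/eqP; rewrite eqEcard sAB; apply: maxA.
Qed.

Section Sums.
Variable R : nzRingType.
Local Open Scope ring_scope.

Lemma sum_flags_top M (F : {set {set T}} -> R) : M != set0 ->
  \sum_(C in flags M | M \in C) F C = \sum_(C in proper_flags M) F (M |: C).
Proof.
move=> M0; rewrite (reindex_onto (fun C => M |: C) (fun C => C :\ M)) /=; last first.
  by move=> C /andP[_ MC]; rewrite setD1K.
apply: eq_bigl => C; rewrite setU11 andbT [in RHS]inE.
case: (boolP (M \in C)) => MC /=.
  rewrite andbF; apply/negbTE; rewrite negb_and orbC; apply/orP; left.
  by apply: contraL MC => /eqP <-; rewrite !inE eqxx.
rewrite setU1K // eqxx !andbT; apply/flagsP/flagsP => -[cC hC]; split.
- by apply: chain_sub cC; apply: subsetUr.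
- by move=> A hA; apply: hC; rewrite inE hA orbT.
- by apply: chainU1 => // A /hC[].
- by move=> A /setU1P[->|/hC].
Qed.

Lemma sum_flags M (F : {set {set T}} -> R) : M != set0 ->
  \sum_(C in flags M) F C = \sum_(C in proper_flags M) (F C + F (M |: C)).
Proof.
move=> M0; rewrite (bigID (fun C => M \in C)) /= sum_flags_top // big_split /= addrC.
by congr (_ + _); apply: eq_bigl => C; rewrite [in RHS]inE.
Qed.

(** Prescribing the union of a nonempty chain is prescribing its top member. *)
Lemma proper_flags_sub M S C : S != set0 -> S \proper M ->
  (C \in proper_flags M) && (cover C == S) = (C \in flags S) && (S \in C).
Proof.
move=> S0 sSM; apply/andP/andP.
  rewrite inE => -[/andP[/flagsP[cC hC] MC] /eqP covC].
  have C0 : C != set0.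
    by apply: contraNneq S0 => C0; rewrite -covC C0 /cover big_set0.
  split; last by rewrite -covC chain_cover.
  apply/flagsP; split => // A hA; split; first by case: (hC A hA).
  by rewrite -covC (bigcup_sup A).
move=> [/flagsP[cC hC] SC]; split.
  rewrite inE; apply/andP; split.
    apply/flagsP; split => // A /hC[A0 sAS]; split => //.
    exact: subset_trans sAS (proper_sub sSM).
  by apply: contraL sSM => /hC[_ sMS]; rewrite properE sMS andbF.
rewrite eqEsubset (bigcup_sup S) // andbT; apply/bigcupsP => A /hC[] //.
Qed.

Lemma flags0 : flags set0 = [set set0].
Proof.
apply/setP => C; rewrite [RHS]inE; apply/flagsP/eqP => [[_ hC]|->]; last first.
  by split=> [|A]; [apply/chainP => A B|]; rewrite inE.
apply/setP => A; rewrite inE; apply/negP => /hC[A0].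
by rewrite subset0 (negbTE A0).
Qed.

Lemma proper_flags0 : proper_flags set0 = [set set0].
Proof.
apply/setP => C; rewrite [in LHS]inE flags0 inE.
by case: eqP => // ->; rewrite inE.
Qed.

Variable t : R.

(** For nonempty M, this is the face polynomial of the permutohedron of dimension [#|M|.-1]: a chain
    C of proper nonempty subsets indexes a face of codimension [#|C|]. *)
Definition flag_sum M := \sum_(C in proper_flags M) t ^+ (#|M|.-1 - #|C|).

Lemma flag_sum0 : flag_sum set0 = 1.
Proof. by rewrite /flag_sum proper_flags0 big_set1 !cards0. Qed.

(* Group the flags by their largest member, which is their union. *)
Lemma flag_sum_rec M : M != set0 ->
  flag_sum M = \sum_(S : {set T} | S \proper M) t ^+ (#|M| - #|S|).-1 * flag_sum S.
Proof.
move=> M0; rewrite /flag_sum.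
rewrite (partition_big (@cover T) (fun S : {set T} => S \proper M)) /=; last first.
  move=> C; rewrite inE => /andP[/flagsP[cC hC] MC].
  have [->|C0] := eqVneq C set0.
    by rewrite /cover big_set0 proper0.
  have cov := chain_cover cC C0.
  rewrite properEneq (hC _ cov).2 andbT.
  by apply: contraNneq MC => <-.
(* Members are nonempty, so the union is empty only for the empty chain, and then S is not a member
   of it. *)
apply: eq_bigr => S sSM; have [S0|S0] := eqVneq S set0.
  rewrite (big_pred1 set0) => [|C]; last first.
    rewrite [in RHS]/= S0; apply/andP/eqP => [[]|->]; last first.
      rewrite /cover big_set0 eqxx inE in_set0 andbT; split=> //.
      by apply/flagsP; split=> [|A]; [apply/chainP => A B|]; rewrite inE.
    rewrite inE => /andP[/flagsP[cC hC] _] cov; apply/eqP.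
    case: (eqVneq C set0) => // C0.
    by have [] := hC _ (chain_cover cC C0); rewrite cov.
  by rewrite S0 -/(flag_sum set0) flag_sum0 mulr1 !cards0 !subn0.
rewrite (eq_bigl _ _ (fun C => proper_flags_sub C S0 sSM)) sum_flags_top //.
rewrite mulr_sumr; apply: eq_bigr => C CS; rewrite -exprD; congr (_ ^+ _).
have lt1 := proper_flags_card S0 CS; have lt2 := proper_card sSM.
have SC : S \notin C by case/setIdP: CS.
rewrite cardsU1 SC; move: lt1 lt2; move: #|C| #|S| #|M| => c s m /=; lia.
Qed.

(** Pair each proper flag C with [M |: C]: the exponents differ by one, which gives the factor
    [1 + t]. *)
Lemma sum_flags_expr M : M != set0 ->
  \sum_(C in flags M) t ^+ (#|M| - #|C|) = (1 + t) * flag_sum M.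
Proof.
move=> M0; rewrite sum_flags // mulr_sumr; apply: eq_bigr => C CM.
have := proper_flags_card M0 CM; move: CM; rewrite inE cardsU1 => /andP[_ ->] cM.
rewrite mulrDl mul1r -exprS addrC; congr (_ ^+ _ + _ ^+ _); lia.
Qed.

End Sums.
End Chains.

(** * Uniqueness of solutions of the recursion over proper subsets *)

Section CardRecursion.
Variables (R : nzRingType) (t : R).
Local Open Scope ring_scope.

Lemma sum_proper_by_card (T : finType) (M : {set T}) (V : nmodType) (F : {set T} -> V) :
  \sum_(S : {set T} | S \proper M) F S =
  \sum_(j < #|M|) \sum_(S : {set T} | (S \subset M) && (#|S| == j)) F S.
Proof.
have [M0|M0] := posnP #|M|.
  rewrite M0 big_ord0 big_pred0 // => S; apply/negP => /proper_card; by rewrite M0.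
rewrite (eq_bigr (fun j : 'I_#|M| =>
    \sum_(S : {set T} | (S \proper M) && (#|S| == j)) F S)); last first.
  move=> j _; apply: eq_bigl => S; rewrite properEcard.
  by case: eqP => [->|]; rewrite ?ltn_ord ?andbT ?andbF.
rewrite (exchange_big_dep (fun S : {set T} => S \proper M)) /= => [|? ? _ /andP[] //].
  apply: eq_bigr => S sSM; rewrite (big_pred1 (Ordinal (proper_card sSM))) // => j.
  by rewrite sSM /= eq_sym -val_eqE.
Qed.

(** Strong induction on the size: by induction the values on subsets of size j agree, and there are
    equally many such subsets on both sides. The two types may differ because the flags live on any
    finite type and the descents on ordinals. *)
Lemma recursion_card_unique (T T' : finType) (f : {set T} -> R) (g : {set T'} -> R) :
  f set0 = 1 -> g set0 = 1 ->
  (forall M : {set T}, M != set0 ->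
     f M = \sum_(S : {set T} | S \proper M) t ^+ (#|M| - #|S|).-1 * f S) ->
  (forall M : {set T'}, M != set0 ->
     g M = \sum_(S : {set T'} | S \proper M) t ^+ (#|M| - #|S|).-1 * g S) ->
  forall (M : {set T}) (M' : {set T'}), #|M| = #|M'| -> f M = g M'.
Proof.
move=> f0 g0 fE gE M M'.
have [m] := ubnP #|M|; elim: m M M' => // m IH M M'; rewrite ltnS => leMm eqMM'.
have [M0|M0] := eqVneq M set0.
  have /eqP : #|M'| = 0 by rewrite -eqMM' M0 cards0.
  by rewrite cards_eq0 M0 => /eqP ->; rewrite f0.
have M'0 : M' != set0 by rewrite -card_gt0 -eqMM' card_gt0.
rewrite fE // gE // !sum_proper_by_card -eqMM'; apply: eq_bigr => j _.
have sub (X : finType) (Y : {set X}) : #|Y| = #|M| -> exists2 S : {set X}, S \subset Y & #|S| = j.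
  move=> cY; have := cards_draws Y j; rewrite cY => cd.
  have : (0 < 'C(#|M|, j))%N by rewrite bin_gt0 ltnW.
  by rewrite -cd card_gt0 => /set0Pn[S]; rewrite inE => /andP[? /eqP ?]; exists S.
(* The induction hypothesis only compares [f] with [g], so two values of [f] at size j are compared
   through [g S1]. *)
have [S0 sS0 cS0] := sub _ M erefl; have [S1 sS1 cS1] := sub _ M' (esym eqMM').
have ltj : (j < m)%N by apply: leq_trans leMm.
have cst (X : finType) (Y : {set X}) (h : {set X} -> R) :
    (forall S : {set X}, #|S| = j -> h S = f S0) -> #|Y| = #|M| ->
    \sum_(S : {set X} | (S \subset Y) && (#|S| == j)) t ^+ (#|M| - #|S|).-1 * h S =
    (t ^+ (#|M| - j).-1 * f S0) *+ 'C(#|M|, j).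
  move=> hh cY; rewrite (eq_bigr (fun=> t ^+ (#|M| - j).-1 * f S0)); last first.
    by move=> S /andP[_ /eqP cS]; rewrite cS hh.
  rewrite sumr_const; congr (_ *+ _).
  have := cards_draws Y j; rewrite cY => <-; apply: eq_card => S.
  by rewrite [in RHS]inE.
rewrite !cst // => S cS; first by rewrite -(IH S0) ?cS0 ?cS.
by rewrite (IH S S1) ?(IH S0 S1) ?cS0 ?cS ?cS1.
Qed.

End CardRecursion.

(** * Eulerian polynomials *)

Section Descents.
Variable n : nat.
Implicit Types (s : seq 'I_n) (M S : {set 'I_n}).

Let gt (x y : 'I_n) := (y < x)%N.

Fixpoint seq_des s :=
  if s is x :: s' then (if s' is y :: _ then (y < x)%N : nat else 0) + seq_des s' else 0.

Definition dec_enum M := rev (enum M).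

Lemma dec_enum_sorted M : sorted gt (dec_enum M).
Proof.
rewrite rev_sorted /gt; apply: (@sorted_filter _ (relpre val ltn)).
  by move=> y x z; apply: ltn_trans.
by rewrite -enumT -sorted_map val_enum_ord iota_ltn_sorted.
Qed.

Lemma mem_dec_enum M : dec_enum M =i M.
Proof. by move=> x; rewrite mem_rev mem_enum. Qed.

Lemma uniq_dec_enum M : uniq (dec_enum M).
Proof. by rewrite rev_uniq enum_uniq. Qed.

Lemma size_dec_enum M : size (dec_enum M) = #|M|.
Proof. by rewrite size_rev -cardE. Qed.

Lemma sorted_dec_enum s M : sorted gt s -> s =i M -> s = dec_enum M.
Proof.
move=> ss sM; apply: (@irr_sorted_eq _ gt) => //.
- by move=> y x z; rewrite /gt => h1 h2; apply: ltn_trans h1.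
- by move=> x; rewrite /gt ltnn.
- exact: dec_enum_sorted.
- by move=> x; rewrite sM mem_dec_enum.
Qed.

Variables (R : comNzRingType) (t : R).
Local Open Scope ring_scope.

(* Split off a decreasing prefix of each length: t = (1 + t) - 1 makes the sum telescope. *)
Lemma des_expand s : s != [::] ->
  (1 + t) ^+ seq_des s =
  \sum_(j < size s | sorted gt (take j.+1 s)) t ^+ j * (1 + t) ^+ seq_des (drop j.+1 s).
Proof.
elim: s => // x [_ _|y s IH _]; first by rewrite big_mkcond big_ord1 /= mul1r.
rewrite big_mkcond -[size _]/(size (y :: s)).+1 big_ord_recl.
rewrite -[X in _ = X + _]/(1 * (1 + t) ^+ seq_des (y :: s)) mul1r.
rewrite -[seq_des (x :: y :: s)]/((y < x) + seq_des (y :: s))%N exprD.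
set d := (1 + t) ^+ seq_des (y :: s).
suff -> : \sum_(j < size (y :: s)) (if sorted gt (take (lift ord0 j).+1 [:: x, y & s])
      then t ^+ lift ord0 j * (1 + t) ^+ seq_des (drop (lift ord0 j).+1 [:: x, y & s])
      else 0) = if (y < x)%N then t * d else 0.
  by case: ifP => _; ring.
case: ifP => lt; last by rewrite big1 // => j _ /=; rewrite {1}/gt lt.
rewrite /d IH // mulr_sumr [RHS]big_mkcond; apply: eq_bigr => j _.
by rewrite /= {1}/gt lt /=; case: ifP => // _; rewrite exprS mulrA.
Qed.

(** At [t] = ['X - 1] and M the full set this is the Eulerian polynomial; the recursion needs
    arbitrary subsets M. *)
Definition des_sum M := \sum_(s <- permutations (enum M)) (1 + t) ^+ seq_des s.

(** A decreasing prefix is determined by its set of entries, hence by the set S of remaining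
    entries, which the suffix arranges arbitrarily. *)
Lemma sum_dec_prefix M (k : nat) (F : seq 'I_n -> R) : (k <= #|M|)%N ->
  \sum_(s <- permutations (enum M) | sorted gt (take k s)) F (drop k s) =
  \sum_(S : {set 'I_n} | (S \subset M) && (#|S| == #|M| - k)%N)
     \sum_(s <- permutations (enum S)) F s.
Proof.
move=> kM.
pose L := [seq dec_enum (M :\: A) ++ s
  | A <- enum [set S : {set 'I_n} | (S \subset M) && (#|S| == #|M| - k)%N],
    s <- permutations (enum A)].
have cD S : S \subset M -> #|S| = (#|M| - k)%N -> #|M :\: S| = k.
  by move=> sSM cS; rewrite cardsD (setIidPr sSM) cS subKn.
have pE S s : (s \in permutations (enum S)) = uniq s && [forall x, (x \in s) == (x \in S)].
  rewrite mem_permutations; apply/idP/andP => [e|[us /forallP h]].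
    rewrite (perm_uniq e) enum_uniq; split=> //; apply/forallP => x.
    by rewrite (perm_mem e) mem_enum.
  by apply: uniq_perm; rewrite ?enum_uniq // => x; rewrite mem_enum; apply/eqP/h.
have -> : \sum_(S : {set 'I_n} | (S \subset M) && (#|S| == #|M| - k)%N)
     \sum_(s <- permutations (enum S)) F s = \sum_(s <- L) F (drop k s).
  rewrite big_allpairs_dep /= big_enum /=.
  apply: eq_big => [S|S /andP[sSM /eqP cS]]; first by rewrite inE.
  by apply: eq_bigr => s _; rewrite drop_size_cat // size_dec_enum cD.
rewrite -big_filter; apply: perm_big; apply: uniq_perm.
- by rewrite filter_uniq ?permutations_uniq.
- apply: allpairs_uniq_dep => [|S _|]; rewrite ?enum_uniq ?permutations_uniq //.
  move=> _ _ /allpairsPdep[S [s [SE sE ->]]] /allpairsPdep[S' [s' [SE' sE' ->]]] /=.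
  move: SE SE'; rewrite !mem_enum !inE => /andP[sS /eqP cS] /andP[sS' /eqP cS'].
  move/eqP; rewrite eqseq_cat ?size_dec_enum ?cD // => /andP[/eqP _ /eqP ss'].
  subst s'; suff -> : S = S' by [].
  apply/setP => x; move: sE sE'; rewrite !pE.
  by move=> /andP[_ /forallP/(_ x)/eqP <-] /andP[_ /forallP/(_ x)/eqP <-].
- move=> s; rewrite mem_filter; apply/andP/allpairsPdep.
    rewrite pE => -[ss /andP[us /forallP sM]].
    have sz : size s = #|M|.
      rewrite cardE; apply/perm_size/uniq_perm; rewrite ?enum_uniq // => x.
      by rewrite mem_enum; apply/eqP.
    move: us; rewrite -[s in uniq s](cat_take_drop k) cat_uniq => /and3P[ut dj ud].
    have dS : #|[set x in drop k s]| = (#|M| - k)%N.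
      by rewrite cardsE (card_uniqP ud) size_drop sz.
    exists [set x in drop k s], (drop k s); split.
    - rewrite mem_enum inE dS eqxx andbT; apply/subsetP => x; rewrite inE.
      by move=> /mem_drop; rewrite (eqP (sM x)).
    - by rewrite pE ud; apply/forallP => x; rewrite inE.
    - rewrite -[LHS](cat_take_drop k); congr (_ ++ _); apply: sorted_dec_enum => // x.
      have := sM x; rewrite -{1}(cat_take_drop k s) mem_cat !inE => /eqP <-.
      case: (boolP (x \in drop k s)) => xd; rewrite ?orbF ?orbT //=.
      by apply/negbTE; apply: contra dj => xt; apply/hasP; exists x.
  move=> [S [s' [SE]]]; rewrite pE => /andP[us' /forallP s'S] ->.
  move: SE; rewrite mem_enum inE => /andP[sSM /eqP cS].
  rewrite take_size_cat ?size_dec_enum ?cD // dec_enum_sorted; split=> //.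
  rewrite pE cat_uniq uniq_dec_enum us' andbT /=; apply/andP; split.
    by apply/hasPn => x; rewrite (eqP (s'S x)) => xS /=; rewrite mem_dec_enum in_setD xS.
  apply/forallP => x; rewrite mem_cat mem_dec_enum inE (eqP (s'S x)).
  by case: (boolP (x \in S)) => /= [/(subsetP sSM) ->|_]; rewrite ?orbT ?orbF.
Qed.

Lemma des_sum0 : des_sum set0 = 1.
Proof. by rewrite /des_sum enum_set0 big_seq1. Qed.

Lemma des_sum_rec M : M != set0 ->
  des_sum M = \sum_(S : {set 'I_n} | S \proper M) t ^+ (#|M| - #|S|).-1 * des_sum S.
Proof.
move=> M0; rewrite /des_sum big_seq.
have M1 : (0 < #|M|)%N by rewrite card_gt0.
have szE s : s \in permutations (enum M) -> size s = #|M|.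
  by rewrite mem_permutations => /perm_size ->; rewrite -cardE.
under eq_bigr => s sE.
  rewrite des_expand; last by rewrite -size_eq0 szE // -lt0n.
  rewrite szE //. over.
(* Reversing the index makes [j] the number of entries left after the prefix, that is, the size of
   S. *)
rewrite -big_seq (exchange_big_dep predT) //= sum_proper_by_card (reindex_inj rev_ord_inj) /=.
apply: eq_bigr => j _.
under eq_bigr do rewrite subnSK //.
rewrite (eq_bigl (fun s => sorted gt (take (#|M| - j) s))); last by move=> s; rewrite subnSK.
rewrite -mulr_sumr (sum_dec_prefix (fun s => (1 + t) ^+ seq_des s)) ?leq_subr //.
rewrite subKn 1?ltnW // mulr_sumr.
apply: eq_bigr => S /andP[_ /eqP ->]; by rewrite subnS.
Qed.

End Descents.

Section Eulerian.
Local Open Scope ring_scope.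

Lemma seq_desE n (s : seq 'I_n) x0 :
  seq_des s = (\sum_(i < size s) ((i.+1 < size s) && (nth x0 s i.+1 < nth x0 s i)))%N.
Proof.
elim: s => [|x s IH]; first by rewrite big_ord0.
by rewrite [size _]/= big_ord_recl /= IH; case: s {IH}.
Qed.

Lemma des_seq_des k (s : 'S_k) : des s = seq_des [seq s i | i <- enum 'I_k].
Proof.
case: k s => [|k] s.
  by rewrite /des eq_card0 => [|[]//]; rewrite (size0nil (size_enum_ord 0)).
have sz : size [seq s i | i <- enum 'I_k.+1] = k.+1 by rewrite size_map size_enum_ord.
rewrite (seq_desE _ ord0) sz /des -sum1_card big_mkcond; apply: eq_bigr => i _ /=.
rewrite inE; have [lt|ge] /= := ltnP i.+1 k.+1; last first.
  case: existsP => // -[j /andP[/eqP ji _]].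
  by have := leq_trans (ltn_ord j) ge; rewrite ji ltnn.
have nthE (j : 'I_k.+1) : nth ord0 [seq s i | i <- enum 'I_k.+1] j = s j.
  by rewrite (nth_map ord0) ?size_enum_ord // nth_ord_enum.
rewrite (nthE i) (nthE (Ordinal lt)); case: existsP => [[j /andP[/eqP ji]]|no].
  by have -> : j = Ordinal lt by [apply: val_inj]; move=> ->.
by case: (boolP (_ < _)%N) => // h; case: no; exists (Ordinal lt); rewrite eqxx.
Qed.

Lemma eulerianE k : eulerian k = des_sum ('X - 1) [set: 'I_k].
Proof.
rewrite /eulerian /des_sum addrC subrK.
pose l (s : 'S_k) := [seq s i | i <- enum 'I_k].
rewrite (eq_bigr (fun s => 'X ^+ seq_des (l s))) => [|s _]; last by rewrite des_seq_des.
rewrite -(big_map l predT (fun s => 'X ^+ seq_des s)); apply: perm_big; apply: uniq_perm.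
- rewrite map_inj_uniq ?index_enum_uniq // => s1 s2 /eq_in_map e; apply/permP => i.
  by apply: e; rewrite mem_enum.
- exact: permutations_uniq.
- move=> r; rewrite mem_permutations enum_setT -enumT; apply/mapP/idP => [[s _ ->]|].
    apply: uniq_perm; rewrite ?enum_uniq //.
      by rewrite (map_inj_uniq (@perm_inj _ s)) enum_uniq.
    move=> i; rewrite mem_enum; apply/mapP; exists (s^-1%g i); by rewrite ?mem_enum ?permKV.
  rewrite -[enum _]/(tval (ord_tuple k)) => /tuple_permP[p ->]; exists p.
    by rewrite mem_index_enum.
  by apply: eq_map => i; rewrite tnth_ord_tuple.
Qed.

Lemma flag_sum_eulerian (T : finType) (M : {set T}) :
  flag_sum ('X - 1) M = eulerian #|M|.
Proof.
rewrite eulerianE; apply: (@recursion_card_unique _ ('X - 1)).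
- exact: flag_sum0.
- exact: des_sum0.
- exact: flag_sum_rec.
- exact: des_sum_rec.
- by rewrite cardsT card_ord.
Qed.

End Eulerian.

(** * Generating functions of all pairs (N, C) and of the redundant ones *)

Section Counting.
Variable n : nat.
Local Open Scope ring_scope.

Lemma sum_card_sets (V : nmodType) (F : nat -> V) :
  \sum_(M : {set 'I_n}) F #|M| = \sum_(k < n.+1) F k *+ 'C(n, k).
Proof.
have le (M : {set 'I_n}) : (#|M| < n.+1)%N by rewrite ltnS -[leqRHS]card_ord max_card.
rewrite (partition_big (fun M : {set 'I_n} => Ordinal (le M)) predT) //=.
apply: eq_bigr => k _; rewrite (eq_bigr (fun=> F k)) => [|M /eqP <- //].
rewrite sumr_const; congr (_ *+ _).
have := card_draws 'I_n k; rewrite card_ord => <-; apply: eq_card => M.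
by rewrite [RHS]inE.
Qed.

(** The factor ['X] is [1 + t] at [t] = ['X - 1]; it is absent for empty M, whose only flag is the
    empty one. *)
Lemma sum_flags_eulerian (M : {set 'I_n}) :
  \sum_(C in flags M) ('X - 1) ^+ (#|M| - #|C|) =
  if #|M| == 0 then 1 else 'X * eulerian #|M| :> {poly int}.
Proof.
case: ifP => [|/negbT]; rewrite cards_eq0 => M0.
  by rewrite (eqP M0) flags0 big_set1 !cards0.
by rewrite sum_flags_expr // flag_sum_eulerian addrC subrK.
Qed.

(** Passing to the complement M of N, the inner sum depends only on [#|M|]; the empty M yields the
    leading 1. *)
Lemma sum_data :
  \sum_(D : {set 'I_n} * {set {set 'I_n}} | D.2 \in flags (~: D.1))
    ('X - 1) ^+ (n - #|D.1| - #|D.2|) = binomial_eulerian n.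
Proof.
rewrite -(pair_big_dep predT (fun N C => C \in flags (~: N))
  (fun N C => ('X - 1) ^+ (n - #|N| - #|C|))) /=.
rewrite (reindex_inj (@setC_inj _)) /=.
rewrite (eq_bigr (fun M : {set 'I_n} =>
  if #|M| == 0 then 1 else 'X * eulerian #|M|)) => [|M _]; last first.
  rewrite -sum_flags_eulerian setCK; apply: eq_bigr => C _.
  have := cardsC M; rewrite card_ord => cM; congr (_ ^+ (_ - _)).
  by move: cM; move: #|M| #|~: M| => m m'; lia.
rewrite (sum_card_sets (fun k => if k == 0 then 1 else 'X * eulerian k)).
rewrite big_ord_recl /= bin0 mulr1n /binomial_eulerian; congr (_ + _).
rewrite big_add1 /= big_mkord mulr_sumr; apply: eq_bigr => k _.
by rewrite mulrnAr.
Qed.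

(** A chain has at most one member of size n-1, so the sum splits over the n points i whose
    complement is a member. For fixed i the chains with and without the full set pair up, giving
    ['X] times the flag sum of an (n-1)-set. *)
Lemma sum_degenerate_data : (1 < n)%N ->
  \sum_(C in flags [set: 'I_n] | [exists A in C, #|A| == n.-1])
    ('X - 1) ^+ (n - #|C|) = ('X * eulerian n.-1) *+ n :> {poly int}.
Proof.
move=> n1.
have cS (i : 'I_n) : #|[set~ i]| = n.-1.
  have := cardsC [set i]; rewrite cards1 card_ord.
  by move: #|_| => m; lia.
have S0 (i : 'I_n) : [set~ i] != set0 by rewrite -card_gt0 cS; lia.
rewrite (eq_bigl (fun C => (C \in flags [set: 'I_n]) && [exists i, [set~ i] \in C])); last first.
  move=> C; case: (C \in _) => //=; apply/exists_inP/existsP => [[A hA cA]|[i iC]].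
    have /cards1P[i iE] : #|~: A| == 1%N.
      have := cardsC A; rewrite card_ord (eqP cA); move: #|_| => m.
      by lia.
    by exists i; rewrite -iE setCK.
  by exists [set~ i]; rewrite ?cS.
have T0 : [set: 'I_n] != set0 by rewrite -card_gt0 cardsT card_ord; lia.
pose G (C : {set {set 'I_n}}) : {poly int} := ('X - 1) ^+ (n - #|C|).
(* A member comparable with [[set~ i]] but not inside it can only be the full set. *)
have topE i C : (C \in proper_flags [set: 'I_n]) && ([set~ i] \in C) =
                (C \in flags [set~ i]) && ([set~ i] \in C).
  have TS : [set: 'I_n] \subset [set~ i] = false.
    by apply/negP => /subset_leq_card; rewrite cS cardsT card_ord; lia.
  apply/andP/andP => -[CF iC]; split=> //.
    move: CF; rewrite inE => /andP[/flagsP[/chainP cC hC] TC].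
    apply/flagsP; split=> [|A hA]; first exact/chainP.
    split; first by case: (hC A hA).
    case/orP: (cC _ _ hA iC) => // sSA; apply: contraNT TC => nAS.
    suff <- : A = [set: 'I_n] by [].
    apply/eqP; rewrite eqEcard subsetT cardsT card_ord.
    have : [set~ i] \proper A by rewrite properE sSA.
    by move=> /proper_card; rewrite cS; lia.
  move/flagsP: CF => [cC hC]; rewrite inE; apply/andP; split.
    by apply/flagsP; split=> // A /hC[]; rewrite subsetT.
  by apply/negP => /hC[_]; rewrite TS.
have one i : \sum_(C in flags [set: 'I_n] | [set~ i] \in C) G C = 'X * eulerian n.-1.
  rewrite big_mkcondr sum_flags //.
  under eq_bigr => C CF.
    have -> : ([set~ i] \in [set: 'I_n] |: C) = ([set~ i] \in C).
      rewrite !inE; case: eqP => // eT.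
      by have := cS i; rewrite eT cardsT card_ord; lia.
    rewrite (_ : _ + _ = if [set~ i] \in C then G C + G ([set: 'I_n] |: C) else 0); last first.
      by case: ifP; rewrite ?addr0.
    over.
  rewrite -big_mkcondr (eq_bigl _ _ (topE i)) sum_flags_top //.
  rewrite -(cS i) -flag_sum_eulerian /flag_sum mulr_sumr; apply: eq_bigr => C CF.
  have Cl := proper_flags_card (S0 i) CF; rewrite cS in Cl.
  have iC : [set~ i] \notin C by case/setIdP: CF.
  have TC : [set: 'I_n] \notin [set~ i] |: C.
    move: (CF) iC; rewrite inE => /andP[/flagsP[_ hC] _] iC.
    apply/negP => /setU1P[eT|/hC[_ /subset_leq_card]]; last first.
      by rewrite cS cardsT card_ord; lia.
    by have := cS i; rewrite -eT cardsT card_ord; lia.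
  rewrite /G !cardsU1 TC iC cS /=.
  move: n1 Cl; move: #|C| => c n1 Cl.
  have -> : (n - (1 + c) = (n.-2 - c).+1)%N by lia.
  have -> : (n - (1 + (1 + c)) = n.-2 - c)%N by lia.
  by rewrite exprS; ring.
rewrite big_mkcondr /=; under eq_bigr => C CF.
  rewrite (_ : (if _ then _ else _) = \sum_(i < n) if [set~ i] \in C then G C else 0).
    over.
  case: existsP => [[i iC]|no]; last first.
    by rewrite big1 // => i _; case: ifP => // h; case: no; exists i.
  rewrite -big_mkcond (big_pred1 i) // => j; apply/idP/eqP => [jC|-> //].
  have /flagsP[cC _] := CF.
  have := chain_card_inj cC jC iC; rewrite !cS => /(_ erefl) /setC_inj.
  by move/set1_inj.
rewrite exchange_big /=; under eq_bigr do rewrite -big_mkcondr one.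
by rewrite sumr_const card_ord.
Qed.

End Counting.

(** * The face lattice *)

(* Rank the points by the number of members of C containing them, ties broken by index. *)
Lemma chain_rank n (C : {set {set 'I_n}}) : chain C ->
  exists s : {perm 'I_n}, forall S, S \in C -> forall i, (i \in S) = (s i < #|S|).
Proof.
move=> /chainP cC.
pose key i := #|[set S in C | i \in S]|.
pose before (i j : 'I_n) := (key j < key i) || (key i == key j) && (i < j).
have before_irr i : before i i = false by rewrite /before !ltnn eqxx.
have before_trans : transitive before.
  by move=> j i k; rewrite /before; lia.
have before_total i j : i != j -> before i j || before j i.
  by rewrite -val_eqE /before /=; lia.
pose r i := #|[set j | before j i]|.
have r_lt i j : before i j -> r i < r j.
  move=> ij; apply/proper_card/properP; split.
    by apply/subsetP => k; rewrite !inE => /before_trans; apply.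
  by exists i; rewrite inE ?before_irr.
have r_ub i : r i < n.
  rewrite -[X in _ < X]card_ord -cardsT; apply/proper_card/properP; split.
    exact: subsetT.
  by exists i; rewrite inE ?before_irr.
pose f i := Ordinal (r_ub i).
have f_inj : injective f.
  move=> i j [] rij; apply/eqP; apply: contraT => /before_total /orP[] /r_lt;
  by rewrite rij ltnn.
exists (perm f_inj) => S SC i; rewrite permE /=.
(* A member containing k is not inside S, so it contains S and hence j; S itself contains j but not
   k. *)
have sep j k : j \in S -> k \notin S -> before j k.
  move=> jS kS; rewrite /before; apply/orP; left; apply/proper_card/properP; split.
    apply/subsetP => A; rewrite !inE => /andP[hA kA]; rewrite hA.
    case/orP: (cC A S hA SC) => [/subsetP/(_ k kA)|/subsetP/(_ j jS) //].
    by rewrite (negbTE kS).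
  by exists S; rewrite inE SC // (negbTE kS).
have [iS|iS] := boolP (i \in S).
  apply/esym/proper_card/properP; split; last by exists i; rewrite ?inE ?before_irr.
  apply/subsetP => j; rewrite inE => ji; apply: contraT => jS.
  by have := before_trans _ _ _ ji (sep i j iS jS); rewrite before_irr.
apply/esym/negbTE; rewrite -leqNgt; apply/subset_leq_card/subsetP => j jS.
by rewrite inE sep.
Qed.

Lemma card_ord_ltn n k : k <= n -> #|[set i : 'I_n | i < k]| = k.
Proof.
move=> kn; have inj : injective (widen_ord kn) by move=> i j /(congr1 val) /= /val_inj.
rewrite -[RHS]card_ord -(card_imset _ inj).
apply: eq_card => i; rewrite inE; apply/idP/imsetP => [lt|[j _ ->]]; last exact: (ltn_ord j).
by exists (Ordinal lt) => //; apply: val_inj.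
Qed.

(** * Sums of the largest bounds, and parking functions as vectors below a permutation of the
    bounds *)

Section Bounds.
Variables (n : nat) (b : n.-tuple nat).
Hypothesis b_gt0 : forall i : 'I_n, 0 < tnth b i.
Implicit Types (i j k : 'I_n) (A : {set 'I_n}) (s : {perm 'I_n}).

(* The partial sums of b in decreasing order, so that tbound ord0 = b_1 + ... + b_n. *)
Definition tbound i := \sum_(j < n | j <= rev_ord i) tnth b j.

Definition gbound d := \sum_(i < n | i < d) tbound i.

Lemma tbound_decr i j : i < j -> tbound j < tbound i.
Proof.
move=> ij; rewrite /tbound [X in _ < X](bigD1 (rev_ord i)) //=.
rewrite -add1n leq_add // big_mkcond [X in _ <= X]big_mkcond; apply: leq_sum => k _.
have -> : (k != rev_ord i) = (k != n - i.+1 :> nat) by [].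
have := ltn_ord i; have := ltn_ord j.
by case: ifP => // h1 h2 h3; case: ifP => // h4; lia.
Qed.

Lemma tbound_ltn i j : (tbound j < tbound i) = (i < j).
Proof.
case: (ltngtP i j) => [/tbound_decr //|/tbound_decr ji|/val_inj ->]; last exact: ltnn.
by apply/negbTE; rewrite -leqNgt ltnW.
Qed.

Lemma tbound_gt0 i : 0 < tbound i.
Proof. by rewrite /tbound (bigD1 (rev_ord i)) //= addn_gt0 b_gt0. Qed.

Lemma tbound_last i : i.+1 = n -> tbound i = nth 0 b 0.
Proof.
move=> iE; rewrite /tbound (big_pred1 (rev_ord i)) => [|j].
  by rewrite (tnth_nth 0) /= iE subnn.
by rewrite -[RHS]/(j == n - i.+1 :> nat) /= iE subnn leqn0.
Qed.

(** The bounds decrease strictly to the last one, which is b_1, so only that one can equal 1. *)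
Lemma tbound_gt1 i : (i.+1 < n) || (nth 0 b 0 != 1) -> 1 < tbound i.
Proof.
have [lt _|ge /=] := ltnP i.+1 n.
  exact: leq_ltn_trans (tbound_gt0 (Ordinal lt)) (@tbound_decr i (Ordinal lt) (ltnSn i)).
move=> b1; have iE : i.+1 = n by apply/eqP; rewrite eqn_leq ge ltn_ord.
by have := tbound_gt0 i; rewrite tbound_last //; move: b1; lia.
Qed.

(** Exchanging an element of A outside the initial segment for a missing one inside gains at least
    1, as the bounds are strictly decreasing integers. This surplus settles the equality case in
    [top_sum_perm_eq]. *)
Lemma top_sum A :
  \sum_(i in A) tbound i + #|A :\: [set i : 'I_n | i < #|A|]| <= gbound #|A|.
Proof.
set I := [set i : 'I_n | i < #|A|].
have An : #|A| <= n by rewrite -[X in _ <= X]card_ord max_card.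
have cI : #|I| = #|A|.
  exact: card_ord_ltn.
have -> : gbound #|A| = \sum_(i in I) tbound i by apply: eq_bigl => i; rewrite inE.
rewrite (big_setID I) [X in _ <= X](big_setID A) /= setIC -addnA leq_add2l.
have cD : #|A :\: I| = #|I :\: A|.
  by apply/eqP; rewrite -(eqn_add2l #|A :&: I|) cardsID setIC cardsID cI.
have [D0|D0] := posnP #|A :\: I|.
  by rewrite (cards0_eq D0) big_set0 cards0.
have [k kD] : exists k, k \in A :\: I by apply/set0Pn; rewrite -card_gt0.
have ltn : #|A| < n by move: kD; rewrite !inE -leqNgt => /andP[/leq_ltn_trans -> //].
(* The bound of rank [#|A|] separates the two sides: elements of A outside the segment have bound at
   most [p], missing elements of the segment have bound above [p]. *)
pose p := tbound (Ordinal ltn).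
apply: (@leq_trans (p * #|A :\: I| + #|A :\: I|)).
  rewrite leq_add2r mulnC -sum_nat_const; apply: leq_sum => i.
  rewrite !inE => /andP[iA _]; rewrite leqNgt tbound_ltn; exact: iA.
rewrite -mulSnr cD mulnC -sum_nat_const; apply: leq_sum => i.
by rewrite !inE => /andP[_ iA]; rewrite tbound_ltn.
Qed.

Lemma top_sum_perm s A : \sum_(i in A) tbound (s i) <= gbound #|A|.
Proof.
have := top_sum (s @: A); rewrite card_imset; last exact: perm_inj.
rewrite big_imset /=; last by move=> ? ? _ _; apply: perm_inj.
by apply: leq_trans; rewrite leq_addr.
Qed.

Lemma top_sum_perm_eq s A :
  (\sum_(i in A) tbound (s i) == gbound #|A|) = [forall i, (i \in A) == (s i < #|A|)].
Proof.
apply/eqP/forallP => [E i|h].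
  have := top_sum (s @: A); rewrite card_imset; last exact: perm_inj.
  rewrite big_imset /=; last by move=> ? ? _ _; apply: perm_inj.
  rewrite E -[X in _ <= X]addn0 leq_add2l leqn0 cards_eq0 setD_eq0 => sub.
  have eqI : s @: A = [set j : 'I_n | j < #|A|].
    apply/eqP; rewrite eqEcard sub /= (card_imset _ (@perm_inj _ s)).
    have An : #|A| <= n by rewrite -[X in _ <= X]card_ord max_card.
    by rewrite card_ord_ltn.
  apply/eqP; have := congr1 (fun X : {set 'I_n} => s i \in X) eqI.
  by rewrite inE mem_imset //; apply: perm_inj.
rewrite /gbound [RHS](reindex_inj (@perm_inj _ s)).
by apply: eq_bigl => i; apply/eqP/h.
Qed.

(** A sorting permutation, reversed, gives [s]. Conversely, if the sorted entry at index i exceeded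
    its partial sum, the n-i entries from there on would need distinct bounds larger than that sum,
    and only n-i-1 exist. *)
Lemma parkingP (beta : n.-tuple nat) :
  is_parking_function b beta <->
  (forall i, 0 < tnth beta i) /\ exists s : {perm 'I_n}, forall i, tnth beta i <= tbound (s i).
Proof.
have sz : size (sort leq beta) == n by rewrite size_sort size_tuple.
have /tuple_permP[p pE] : perm_eq (sort leq beta) beta by rewrite perm_sort.
have nthE i : nth 0 (sort leq beta) i = tnth beta (p i).
  by rewrite pE -tnth_nth tnth_mktuple.
split=> -[pos].
  move=> h; split=> //; exists (p^-1 * perm (@rev_ord_inj n))%g => i.
  by have := h (p^-1 i)%g; rewrite nthE permKV permM (permE (@rev_ord_inj n)) /tbound rev_ordK.
case=> s hs; split=> // i; rewrite leqNgt; apply/negP => gt_i.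
have : (fun j => s (p j)) @: [set j : 'I_n | i <= j] \subset [set k : 'I_n | k < rev_ord i].
  apply/subsetP => _ /imsetP[j ij ->]; rewrite inE in ij; rewrite inE -tbound_ltn.
  rewrite {1}/tbound rev_ordK; apply: leq_trans gt_i _; rewrite nthE.
  apply: leq_trans (hs (p j)); rewrite -!nthE.
  apply: (sorted_leq_nth leq_trans leqnn) => //; last by rewrite inE (eqP sz).
    exact: (sort_sorted leq_total).
  by rewrite inE (eqP sz).
move/subset_leq_card; rewrite card_imset; last by move=> j k /perm_inj /perm_inj.
have -> : [set k : 'I_n | k < rev_ord i] = @rev_ord n @: [set j : 'I_n | i < j].
  apply/setP => k; rewrite inE; apply/idP/imsetP => [lt|[j]].
    exists (rev_ord k); rewrite ?rev_ordK // inE /=.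
    by move: lt => /=; have := ltn_ord k; have := ltn_ord i; lia.
  by rewrite inE => ij -> /=; have := ltn_ord i; have := ltn_ord j; lia.
rewrite card_imset; last exact: rev_ord_inj.
apply/negP; rewrite -ltnNge; apply/proper_card/properP; split.
  by apply/subsetP => j; rewrite !inE => /ltnW.
by exists i; rewrite inE ?ltnn.
Qed.
End Bounds.

Local Open Scope ring_scope.

(** * Convex and affine hulls, dimension, and nonnegative vectors as sums along chains *)

Section Geometry.
Variables (R : realType) (n : nat).
Implicit Types (x y p q w : 'rV[R]_n) (S F : set 'rV[R]_n).

Lemma sub_convex_hull S : (S `<=` convex_hull S)%classic.
Proof. by move=> x Sx A [_]; apply. Qed.

Lemma convex_hull_le S (f : 'rV[R]_n -> R) (a : R) :
  (forall l m x y, f (l *: x + m *: y) = l * f x + m * f y) ->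
  (forall x, S x -> f x <= a) -> forall x, convex_hull S x -> f x <= a.
Proof.
move=> lf Sa x /(_ [set z | f z <= a]%classic); apply; split; last exact: Sa.
move=> y z l; rewrite !in_setE /= => fy fz.
have -> : conv l (y : convex_lmodType _) z = l%:num *: y + (1 - l%:num) *: z by [].
rewrite lf; have -> : a = l%:num * a + (1 - l%:num) * a by ring.
have l0 : 0 <= l%:num by [].
have l1 : l%:num <= 1 by [].
by rewrite lerD // ler_wpM2l // subr_ge0.
Qed.

(** Append p and q with weights [a] and [- a]; the total weight stays 1. *)
Lemma affine_hull_shift S x p q (a : R) :
  affine_hull S x -> S p -> S q -> affine_hull S (x + a *: (p - q)).
Proof.
case=> [m [c [r [Sr c1 ->]]]] Sp Sq.
exists (m + 2)%N,
  (fun i => match fintype.split i with inl j => c j | inr j => if j == 0 then a else - a end),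
  (fun i => match fintype.split i with inl j => r j | inr j => if j == 0 then p else q end).
have sl (j : 'I_m) : fintype.split (lshift 2 j) = inl j by exact: (unsplitK (inl j)).
have sr (j : 'I_2) : fintype.split (rshift m j) = inr j by exact: (unsplitK (inr j)).
split.
- by move=> i; case: (fintype.split i) => j //; case: ifP.
- rewrite big_split_ord /= big_ord_recl big_ord1 !sr /= addrN addr0 -c1.
  by apply: eq_bigr => i _; rewrite sl.
- rewrite big_split_ord /=; congr (_ + _); first by apply: eq_bigr => i _; rewrite sl.
  by rewrite big_ord_recl big_ord1 !sr /= scalerBr scaleNr.
Qed.

Lemma mem_affine_hull S x : S x -> affine_hull S x.
Proof.
move=> Sx; exists 1%N, (fun=> 1), (fun=> x); split=> //; rewrite big_ord1 //.
by rewrite scale1r.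
Qed.

(** Direction vectors are differences of points of the affine hull, so each of the two direction
    spaces contains the other. *)
Lemma has_dim_uniq S d e : has_dim S d -> has_dim S e -> d = e.
Proof.
move=> [x [U [SU <-]]] [y [V [SV <-]]].
have sub z t (A B : {vspace 'rV[R]_n}) : 
  [set z + u | u in [set` A]]%classic = [set t + u | u in [set` B]]%classic -> (A <= B)%VS.
  move=> E; apply/subvP => u uA.
  have : [set t + u | u in [set` B]]%classic (z + u) by rewrite -E; exists u.
  have : [set t + u | u in [set` B]]%classic (z + 0) by rewrite -E; exists 0 => //=; apply: mem0v.
  move=> [v vB vE] [v' v'B vE'].
  have -> : u = v' - v.
    apply: (@addrI _ z); rewrite -vE'; rewrite addr0 in vE.
    by rewrite -vE -addrA [v + _]addrC subrK.
  by apply: memvB.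
apply/eqP; rewrite eqn_leq; apply/andP; split; apply: dimvS.
  by apply: (sub x y); rewrite -SU SV.
by apply: (sub y x); rewrite -SU SV.
Qed.

Lemma has_dim_nonempty S d : has_dim S d -> exists x, S x.
Proof.
move=> [x [U [SU _]]].
have : affine_hull S x by rewrite SU; exists 0; rewrite ?addr0 //=; apply: mem0v.
case=> [[|m] [c [p [Sp c1 _]]]]; last by exists (p ord0).
by move: c1; rewrite big_ord0 => /eqP; rewrite eq_sym oner_eq0.
Qed.

(** Induction on the support: subtracting the least positive value on the support S shrinks it
    strictly, and S becomes the top member of the chain. *)
Lemma nonneg_chain_decomp (c : 'I_n -> R) : (forall i, 0 <= c i) ->
  exists (C : {set {set 'I_n}}) (l : {set 'I_n} -> R),
    [/\ C \in flags [set i | 0 < c i], forall A, A \in C -> 0 < l A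
      & forall i, c i = \sum_(A in C | i \in A) l A].
Proof.
have [m] := ubnP #|[set i | 0 < c i]|; elim: m c => // m IH c; rewrite ltnS => le_m c0.
set S := [set i | 0 < c i] in le_m *.
have [S0|[i0 i0S]] := set_0Vmem S.
  exists set0, (fun=> 0); split=> [||i]; first by rewrite S0 flags0 inE.
    by move=> A; rewrite inE.
  rewrite big_pred0 => [|A]; last by rewrite inE.
  apply/eqP; rewrite eq_le c0 andbT leNgt.
  by apply/negP => ci; have : i \in S by [rewrite inE]; rewrite S0 inE.
have [i1 /= i1S min] := arg_minP c i0S.
have {}i1S : i1 \in S := i1S.
pose d i := if i \in S then c i - c i1 else 0.
have d0 i : 0 <= d i by rewrite /d; case: ifP => // iS; rewrite subr_ge0 min.
have dS : [set i | 0 < d i] \proper S.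
  apply/properP; split; first by apply/subsetP => i; rewrite inE /d; case: ifP; rewrite ?ltxx.
  by exists i1 => //; rewrite inE /d i1S subrr ltxx.
have [|C [l [Cd lC dE]]] := IH d _ d0; first exact: leq_trans (proper_card dS) le_m.
have SC : S \notin C.
  apply/negP => SC; have /flagsP[_ /(_ S SC)[_]] := Cd.
  by move: dS; rewrite properE => /andP[_ /negP].
exists (S |: C), (fun A => if A == S then c i1 else l A); split.
- have /flagsP[cC hC] := Cd.
  apply/flagsP; split.
    by apply: chainU1 => // A /hC[_ /subset_trans]; apply; apply: proper_sub.
  move=> A /setU1P[->|/hC[A0 Ad]]; split=> //; first by apply/set0Pn; exists i0.
  exact: subset_trans Ad (proper_sub dS).
- move=> A /setU1P[->|hA]; first by rewrite eqxx; move: i1S; rewrite inE.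
  by case: eqP => [E|_]; [move: SC; rewrite -E hA|apply: lC].
- move=> i; rewrite big_mkcondr big_setU1 //= eqxx.
  rewrite (eq_bigr (fun A : {set 'I_n} => if i \in A then l A else 0)); last first.
    by move=> A hA; case: (A =P S) => // E; move: SC; rewrite -E hA.
  rewrite -big_mkcondr -dE /d; case: ifP => iS; first by rewrite addrC subrK.
  rewrite add0r; apply/eqP; rewrite eq_le c0 andbT leNgt.
  by apply/negP => ci; move: iS; rewrite inE ci.
Qed.

End Geometry.

(** * Valid inequalities of the polytope and the shape of its faces *)

Section ParkingPolytope.
Variables (R : realType) (n : nat) (b : n.-tuple nat).
Hypothesis b_gt0 : forall i : 'I_n, (0 < tnth b i)%N.
Implicit Types (x y p q w : 'rV[R]_n) (i j k : 'I_n).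
Implicit Types (A N Q : {set 'I_n}) (C : {set {set 'I_n}}) (s : {perm 'I_n}).

Let P := parking_polytope R b.
Let T i : R := (tbound b i)%:R.
Let g d : R := (gbound b d)%:R.

Definition vtx s Q : 'rV[R]_n := \row_i (if i \in Q then 1 else T (s i)).

Lemma vtx_polytope s Q : P (vtx s Q).
Proof.
apply: sub_convex_hull; exists [tuple if i \in Q then 1%N else tbound b (s i) | i < n].
  apply/parkingP => //; split=> [i|].
    by rewrite tnth_mktuple; case: ifP => // _; apply: tbound_gt0.
  by exists s => i; rewrite tnth_mktuple; case: ifP => // _; apply: tbound_gt0.
by apply/rowP => i; rewrite !mxE tnth_mktuple; case: ifP.
Qed.

Lemma polytope_ge1 x i : P x -> 1 <= x ord0 i.
Proof.
move=> Px; rewrite -lerN2; move: x Px; apply: convex_hull_le => [l m x y|x].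
  by rewrite !mxE; ring.
move=> [beta /parkingP[//|pos _] ->]; rewrite mxE lerN2 ler1n; exact: pos.
Qed.

Lemma polytope_sum_le x A : P x -> \sum_(i in A) x ord0 i <= g #|A|.
Proof.
move: x; apply: (@convex_hull_le _ _ _ (fun x => \sum_(i in A) x ord0 i)) => [l m x y|x].
  rewrite !mulr_sumr -big_split /=; apply: eq_bigr => i _; by rewrite !mxE.
move=> [beta /parkingP[//|_ [s hs]] ->].
rewrite (eq_bigr (fun i => (tnth beta i)%:R)) => [|i _]; last by rewrite mxE.
rewrite -natr_sum ler_nat; apply: leq_trans (top_sum_perm b_gt0 s A).
by apply: leq_sum => i _.
Qed.

Definition face N C : set 'rV[R]_n :=
  (P `&` [set x | (forall i, i \in N -> x ord0 i = 1) /\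
                  (forall A, A \in C -> \sum_(i in A) x ord0 i = g #|A|)])%classic.

(** Members of C are initial segments for the ranking [s], so their coordinates carry the largest
    bounds and the sum inequalities are tight. *)
Lemma vtx_face s Q N C : N \subset Q ->
  (forall A, A \in C -> forall i, (i \in A) = (s i < #|A|)%N) ->
  (forall A, A \in C -> A \subset ~: Q) -> face N C (vtx s Q).
Proof.
move=> NQ sC QC; split; first exact: vtx_polytope.
split=> [i iN|A hA]; first by rewrite mxE (subsetP NQ).
rewrite (eq_bigr (fun i => (tbound b (s i))%:R)) => [|i iA]; last first.
  by rewrite mxE; have := subsetP (QC A hA) i iA; rewrite inE => /negbTE ->.
rewrite -natr_sum; congr (_%:R); apply/eqP; rewrite top_sum_perm_eq //.
by apply/forallP => i; rewrite (sC A).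
Qed.

Section Support.
Variables (N : {set 'I_n}) (C : {set {set 'I_n}}) (l : {set 'I_n} -> R) (m : 'I_n -> R).
Hypothesis lC : forall A, A \in C -> 0 < l A.
Hypothesis mN : forall i, i \in N -> 0 < m i.
Variable c : 'rV[R]_n.
Hypothesis cE : forall i, c ord0 i = \sum_(A in C | i \in A) l A - (if i \in N then m i else 0).

Let a := \sum_(A in C) l A * g #|A| - \sum_(i in N) m i.

Let dotvE x : dotv c x =
  \sum_(A in C) l A * \sum_(i in A) x ord0 i - \sum_(i in N) m i * x ord0 i.
Proof.
rewrite /dotv (eq_bigr _ (fun i _ => congr1 (fun z => z * x ord0 i) (cE i))).
rewrite (eq_bigr _ (fun i _ => mulrBl _ _ _)) sumrB; congr (_ - _); last first.
  rewrite [RHS]big_mkcond; apply: eq_bigr => i _; by case: ifP => // _; rewrite mul0r.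
rewrite (eq_bigr _ (fun i _ => mulr_suml _ _ _ _)).
rewrite (exchange_big_dep (mem C)) /= => [|i A _ /andP[]//].
apply: eq_bigr => A hA; rewrite mulr_sumr; apply: eq_bigl => i; by rewrite hA.
Qed.

(** The slack of the functional is a positive combination of the slacks of the inequalities for C
    and N, so on the polytope it vanishes exactly when all of these are tight. *)
Let gap x : a - dotv c x =
  \sum_(A in C) l A * (g #|A| - \sum_(i in A) x ord0 i) + \sum_(i in N) m i * (x ord0 i - 1).
Proof.
rewrite dotvE /a; under [X in _ = X + _]eq_bigr do rewrite mulrBr.
under [X in _ = _ + X]eq_bigr do rewrite mulrBr mulr1.
by rewrite !sumrB; ring.
Qed.

Let gapA x A : P x -> A \in C -> 0 <= l A * (g #|A| - \sum_(i in A) x ord0 i).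
Proof. by move=> Px hA; rewrite mulr_ge0 ?subr_ge0 ?polytope_sum_le // ltW ?lC. Qed.

Let gapN x i : P x -> i \in N -> 0 <= m i * (x ord0 i - 1).
Proof. by move=> Px iN; rewrite mulr_ge0 ?subr_ge0 ?polytope_ge1 // ltW ?mN. Qed.

Lemma support_le x : P x -> dotv c x <= a.
Proof.
move=> Px; rewrite -subr_ge0 gap addr_ge0 // sumr_ge0 // => ? ?.
  exact: gapA.
exact: gapN.
Qed.

Lemma support_face : face N C = (P `&` [set x | dotv c x = a])%classic.
Proof.
apply/seteqP; split=> x [Px]; last first.
  move=> /= E; split=> //.
  have : a - dotv c x = 0 by rewrite E subrr.
  rewrite gap => /eqP; rewrite paddr_eq0; last 2 first.
  - by rewrite sumr_ge0 // => ? ?; apply: gapA.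
  - by rewrite sumr_ge0 // => ? ?; apply: gapN.
  move=> /andP[/eqP sA /eqP sN]; split=> [i iN|A hA].
    have /eqP := psumr_eq0P (fun i => @gapN x i Px) sN iN.
    by rewrite mulf_eq0 gt_eqF ?mN //= subr_eq0 => /eqP.
  have /eqP := psumr_eq0P (fun A => @gapA x A Px) sA hA.
  by rewrite mulf_eq0 gt_eqF ?lC //= subr_eq0 => /eqP.
move=> [xN xC]; split=> //=; apply/eqP; rewrite eq_sym -subr_eq0 gap; apply/eqP.
rewrite !big1 ?addr0 // => [i iN|A hA]; first by rewrite xN // subrr mulr0.
by rewrite xC // subrr mulr0.
Qed.

End Support.

(** Adjoining [~: N] to the chain as top member sends N to the last ranks. *)
Lemma chain_rankC N C : C \in flags (~: N) ->
  exists s, (forall A, A \in C -> forall i, (i \in A) = (s i < #|A|)%N) /\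
            (forall i, (i \in N) = (#|~: N| <= s i)%N).
Proof.
move=> /flagsP[cC hC]; have [|s hs] := @chain_rank _ (~: N |: C).
  by apply: chainU1 => // A /hC[].
exists s; split=> [A hA|i]; first by apply: hs; rewrite inE hA orbT.
by rewrite leqNgt -hs ?setU11 // inE negbK.
Qed.

Lemma face_nonempty N C : C \in flags (~: N) -> exists x, face N C x.
Proof.
move=> CN; have [s [sC _]] := chain_rankC CN; exists (vtx s N).
by apply: vtx_face => // A hA; have /flagsP[_ /(_ A hA)[]] := CN.
Qed.

(** The sum of the inequalities for C and N, all with weight 1, is a supporting functional. *)
Lemma face_is_face N C : is_face P (face N C).
Proof.
pose c : 'rV[R]_n := \row_i (\sum_(A in C | i \in A) 1 - (if i \in N then 1 else 0)).
have cE i : c ord0 i = \sum_(A in C | i \in A) 1 - (if i \in N then 1 else 0) by rewrite mxE.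
exists c, (\sum_(A in C) 1 * g #|A| - \sum_(i in N) 1); split.
  by move=> x; apply: (@support_le N C (fun=> 1) (fun=> 1)).
exact: (@support_face N C (fun=> 1) (fun=> 1)).
Qed.

(** N collects the negative coordinates of the normal [c], and the positive part of [c] decomposes
    along a chain, which is C. *)
Lemma is_face_face F : is_face P F -> (exists x, F x) ->
  exists N C, C \in flags (~: N) /\ F = face N C.
Proof.
move=> [c [a [ca ->]]] [x0 [Px0 /= cx0]].
pose N := [set i | c ord0 i < 0].
pose d i := Num.max (c ord0 i) 0.
have [|C [l [Cd lC dE]]] := @nonneg_chain_decomp R n d; first by move=> i; rewrite le_max lexx orbT.
have CN : C \in flags (~: N).
  have /flagsP[cC hC] := Cd; apply/flagsP; split=> // A /hC[A0 sA]; split=> //.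
  apply: subset_trans sA _; apply/subsetP => i; rewrite !inE lt_max ltxx orbF -leNgt; exact: ltW.
have mN i : i \in N -> 0 < - c ord0 i by rewrite inE oppr_gt0.
have cE i : c ord0 i = \sum_(A in C | i \in A) l A - (if i \in N then - c ord0 i else 0).
  rewrite -dE /d inE; case: ltP => c0; first by rewrite opprK add0r.
  by rewrite subr0.
exists N, C; split=> //; have [v Fv] := face_nonempty CN.
rewrite (support_face lC mN cE) in Fv *; case: Fv => Pv /= cv.
(* Both faces are nonempty, so both right-hand sides equal the maximum of [c] on the polytope. *)
have le1 := ca v Pv; have le2 := support_le lC mN cE Px0.
by congr (_ `&` _)%classic; apply/seteqP; split=> x /= ->;
  apply/eqP; rewrite eq_le; apply/andP; split; lra.
Qed.

Definition degenerate N C := [&& nth 0%N b 0 == 1%N, N == set0 & [exists A in C, #|A| == n.-1]].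

(** * Directions of a face, its dimension, and recovery of N and C from it *)

Section Direction.
Variables (N : {set 'I_n}) (C : {set {set 'I_n}}) (s : {perm 'I_n}).
Hypothesis CN : C \in flags (~: N).
Hypothesis sC : forall A, A \in C -> forall i, (i \in A) = (s i < #|A|)%N.
Hypothesis sN : forall i, (i \in N) = (#|~: N| <= s i)%N.
Let m := #|~: N|.

Lemma rank_bound : (m <= n)%N.
Proof. by rewrite -[X in (_ <= X)%N]card_ord max_card. Qed.

(* With (pi k) the point of rank k, step k is e_(pi k) - e_(pi k.+1), without the
   second term at the end k.+1 = m; the functionals psum k.+1 form its dual basis. *)
Definition step k : 'rV[R]_n :=
  \row_i ((s i == k)%:R - ((s i == k.+1 :> nat) && (k.+1 < m)%N)%:R).

Definition psum d x := \sum_(i | (s i < d)%N) x ord0 i.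

(** Steps k whose dual functional [psum k.+1] is not prescribed by a member of C; they span the
    directions of the face. *)
Definition free_steps := [set k : 'I_n | (k < m)%N & ~~ [exists A in C, #|A| == k.+1]].

Lemma psum_set A x : A \in C -> \sum_(i in A) x ord0 i = psum #|A| x.
Proof. by move=> hA; apply: eq_bigl => i; rewrite sC. Qed.

Lemma psumB d x y : psum d (x - y) = psum d x - psum d y.
Proof. by rewrite -sumrB; apply: eq_bigr => i _; rewrite !mxE. Qed.

Lemma psumZ d a x : psum d (a *: x) = a * psum d x.
Proof. by rewrite mulr_sumr; apply: eq_bigr => i _; rewrite !mxE. Qed.

Lemma psum_sum d (I : finType) (Q : pred I) (F : I -> 'rV[R]_n) :
  psum d (\sum_(i | Q i) F i) = \sum_(i | Q i) psum d (F i).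
Proof. by rewrite exchange_big /=; apply: eq_bigr => i _; rewrite summxE. Qed.

Lemma psumS k x : psum k.+1 x = psum k x + x ord0 (s^-1 k)%g.
Proof.
rewrite /psum (bigD1 (s^-1 k)%g) /= ?permKV // addrC; congr (_ + _).
apply: eq_bigl => i; rewrite ltnS -(inj_eq (@perm_inj _ s)) permKV.
by rewrite ltn_neqAle andbC.
Qed.

Lemma psum0 x : psum 0 x = 0.
Proof. by rewrite /psum big_pred0. Qed.

Lemma psum_step k j : (k < m)%N -> (j < m)%N -> psum k.+1 (step j) = (k == j)%:R.
Proof.
move=> km jm; rewrite /psum; under eq_bigr do rewrite mxE.
rewrite sumrB (reindex_inj (@perm_inj _ (s^-1)%g)).
rewrite [X in _ - X](reindex_inj (@perm_inj _ (s^-1)%g)) /=.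
under eq_bigr do rewrite permKV.
under [X in _ - X]eq_bigr do rewrite permKV.
under eq_bigl do rewrite permKV.
under [X in _ - X]eq_bigl do rewrite permKV.
have E1 : \sum_(i < n | (i < k.+1)%N) (i == j)%:R = (j <= k)%N%:R :> R.
  rewrite big_mkcond (bigD1 j) //= eqxx ltnS big1 ?addr0 => [|i /negbTE ->].
    by case: leqP.
  by case: ifP.
have E2 : \sum_(i < n | (i < k.+1)%N) ((i == j.+1 :> nat) && (j.+1 < m)%N)%:R = (j < k)%N%:R :> R.
  have [lt|ge] := ltnP j.+1 m; last first.
    rewrite big1 => [|i _]; last by rewrite andbF.
    by rewrite ltnNge; have -> : (k <= j)%N by rewrite -ltnS (leq_trans km).
  have jn : (j.+1 < n)%N by apply: leq_trans lt rank_bound.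
  rewrite big_mkcond (bigD1 (Ordinal jn)) //= eqxx ltnS big1 ?addr0 => [|i ij].
    by case: leqP.
  have /negbTE -> : i != j.+1 :> nat by [].
  by case: ifP.
rewrite E1 E2 -[k == j]/(k == j :> nat).
by case: (ltngtP j k) => /=; rewrite ?subrr ?subr0.
Qed.

(** Summation by parts: the coordinate of rank k is [psum k.+1 x - psum k x]. *)
Lemma step_expand x : (forall i, i \in N -> x ord0 i = 0) ->
  x = \sum_(k < n | (k < m)%N) psum k.+1 x *: step k.
Proof.
move=> xN; apply/rowP => i; rewrite summxE.
under eq_bigr do rewrite !mxE mulrBr.
rewrite sumrB; have [lt|ge] := ltnP (s i) m; last first.
  rewrite xN ?sN // !big1 ?subr0 // => k km.
    have [E|_] := eqVneq (s i : nat) k.+1; last by rewrite mulr0.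
    by rewrite ltnNge -E ge mulr0.
  have /negbTE -> : s i != k by apply: contraTneq km => <-; rewrite -leqNgt.
  by rewrite mulr0.
rewrite (bigD1 (s i)) //= eqxx mulr1 big1 ?addr0 => [|k /andP[_ /negbTE]]; last first.
  by rewrite eq_sym => ->; rewrite mulr0.
rewrite psumS permK [_ + x _ _]addrC; set S2 := BIG_F.
suff -> : \sum_(k < n | (k < m)%N) S2 k = psum (s i) x by rewrite addrK.
rewrite /S2 => {S2}; case E : (nat_of_ord (s i)) => [|d].
  by rewrite psum0 big1 // => k _; rewrite mulr0.
have dn : (d < n)%N by apply: ltn_trans (ltn_ord (s i)); rewrite E.
rewrite (bigD1 (Ordinal dn)) /=; last by apply: ltn_trans lt; rewrite E.
rewrite eqxx -E lt mulr1 big1 ?addr0 // => k /andP[_ kd].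
have /negbTE -> : s i != k.+1 :> nat by rewrite E eqSS eq_sym.
by rewrite mulr0.
Qed.

(** In {0, ..., m}, the shifted free steps are the complement of 0 and the sizes of the members of
    C, which are pairwise distinct. *)
Lemma card_free_steps : #|free_steps| = (n - #|N| - #|C|)%N.
Proof.
have mE : (n - #|N| = m)%N.
  by have := cardsC N; rewrite card_ord /m; move: #|N| #|~: N| => c d; lia.
have /flagsP[cC hC] := CN.
have cS A : A \in C -> (0 < #|A| <= m)%N.
  by move=> /hC[A0 AN]; rewrite card_gt0 A0 subset_leq_card.
pose f A : 'I_m.+1 := inord #|A|.
have fE A : A \in C -> f A = #|A| :> nat.
  by move=> /cS /andP[_ ?]; rewrite inordK.
have finj : {in C &, injective f}.
  move=> A B hA hB /(congr1 val) /=; rewrite !fE //; exact: chain_card_inj cC _ _ hA hB.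
pose h k : 'I_m.+1 := inord k.+1.
have hE k : (k < m)%N -> h k = k.+1 :> nat by move=> km; rewrite inordK.
have hinj : {in free_steps &, injective h}.
  move=> k j; rewrite !inE => /andP[km _] /andP[jm _] /(congr1 val) /=.
  by rewrite !hE // => -[] /val_inj.
rewrite mE -(card_in_imset finj) -(card_in_imset hinj).
have -> : h @: free_steps = ~: (ord0 |: f @: C).
  apply/setP => j; rewrite !inE negb_or; apply/imsetP/andP => [[k]|[j0 jC]].
    rewrite inE => /andP[km /exists_inPn kC] ->; split; first by rewrite -val_eqE /= hE.
    apply/imsetP => -[A hA /(congr1 val)] /=; rewrite hE // fE // => E.
    by move: (kC A hA); rewrite -E eqxx.
  have j1 : (0 < j)%N by rewrite lt0n.
  have jm : (j.-1 < m)%N by rewrite prednK // -ltnS.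
  have jn : (j.-1 < n)%N by apply: leq_trans jm rank_bound.
  have hj : h (Ordinal jn) = j by apply: val_inj; rewrite /= hE //= prednK.
  exists (Ordinal jn); rewrite // inE /= jm /= prednK //.
  apply/exists_inPn => A hA; apply: contra jC => /eqP AE.
  by apply/imsetP; exists A => //; apply: val_inj; rewrite /= fE.
have := cardsC (ord0 |: f @: C); rewrite card_ord cardsU1.
have -> : ord0 \notin f @: C.
  apply/imsetP => -[A hA /(congr1 val)] /=; rewrite fE // => E.
  by have := cS A hA; rewrite -E.
by move: #|_ @: _| #|~: _| => c d; lia.
Qed.

Lemma flag_subC A : A \in C -> A \subset ~: N.
Proof. by move=> hA; have /flagsP[_ /(_ A hA)[]] := CN. Qed.

Lemma vtx_in_face s' : (forall A, A \in C -> forall i, (i \in A) = (s' i < #|A|)%N) ->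
  face N C (vtx s' N).
Proof. by move=> s'C; apply: vtx_face => // A; apply: flag_subC. Qed.

(** Lower the coordinate [i0] of rank m-1 from its bound to 1. No member of C has size m, so none
    contains [i0] and their sums are unchanged. The ranking [s'] that assigns the bounds may differ
    from [s]. *)
Lemma face_step_last s' k : (forall A, A \in C -> forall i, (i \in A) = (s' i < #|A|)%N) ->
  k.+1 = m -> k \in free_steps -> (1 < tbound b (s' (s^-1 k)%g))%N ->
  exists p q a, [/\ face N C p, face N C q, a != 0 & p - q = a *: step k].
Proof.
move=> s'C km; rewrite inE => /andP[_ /exists_inPn kC] T1.
set i0 := (s^-1 k)%g in T1 *.
have si0 : s i0 = k by rewrite permKV.
have i0N : i0 \notin N by rewrite sN si0 -ltnNge -/m -km.
exists (vtx s' N), (vtx s' (i0 |: N)), (T (s' i0) - 1); split.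
- exact: vtx_in_face.
- apply: vtx_face => // [|A hA]; first exact: subsetUr.
  rewrite setCU subsetI flag_subC // andbT; apply/subsetP => i iA; rewrite !inE.
  apply: contraTneq iA => ->; rewrite sC // si0 -leqNgt.
  have := subset_leq_card (flag_subC hA); rewrite -/m -km leq_eqVlt.
  by rewrite (negbTE (kC A hA)).
- by rewrite subr_eq0 pnatr_eq1 gtn_eqF.
- apply/rowP => i; rewrite !mxE km ltnn andbF subr0 in_setU1.
  have [->|ii0] /= := eqVneq i i0; first by rewrite (negbTE i0N) si0 eqxx mulr1.
  have /negbTE -> : s i != k by rewrite -si0 (inj_eq (@perm_inj _ s)).
  by rewrite subrr mulr0.
Qed.

(** No member of C has size j+1, so none separates the ranks j and j+1. *)
Lemma swap_adapted j k : k = j.+1 :> nat -> j \in free_steps ->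
  forall A, A \in C -> forall i, (i \in A) = ((s * tperm j k)%g i < #|A|)%N.
Proof.
move=> kj; rewrite inE => /andP[_ /exists_inPn jC] A hA i; rewrite sC // permM.
have := jC A hA; case: tpermP => [->|->|//]; rewrite kj; lia.
Qed.

Hypothesis nontriv : ~ (n = 1%N /\ nth 0%N b 0 = 1%N).
Hypothesis ndeg : ~~ degenerate N C.

(** Below the last rank, exchanging the bounds of two adjacent ranks moves along the step; at the
    last rank, a coordinate is lowered to 1. *)
Lemma face_step k : k \in free_steps ->
  exists p q a, [/\ face N C p, face N C q, a != 0 & p - q = a *: step k].
Proof.
move=> kF; move: (kF); rewrite inE => /andP[km kC].
have := km; rewrite leq_eqVlt => /orP[/eqP kmE|km1].
  have [T1|T1] := ltnP 1 (tbound b k).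
    by apply: (@face_step_last s) => //; rewrite permKV.
  (* Here the last bound already equals 1, so b_1 = 1 and N is empty. Nondegeneracy makes the step
     before it free, and exchanging the last two ranks first gives the coordinate a bound above
     1. *)
  have [b1 kn] : nth 0%N b 0 = 1%N /\ k.+1 = n.
    have := @tbound_gt1 _ _ b_gt0 k; rewrite [(1 < _)%N]ltnNge T1.
    by have := ltn_ord k; case: (nth 0%N b 0 =P 1%N) => // b1; lia.
  have N0 : N = set0.
    have := cardsC N; rewrite card_ord -/m -kmE kn => cN; apply: cards0_eq.
    by move: cN; move: #|N| => c; lia.
  have k0 : (0 < k)%N.
    by rewrite lt0n; apply/eqP => k0; apply: nontriv; split=> //; rewrite -kn k0.
  have jn : (k.-1 < n)%N by apply: leq_ltn_trans (leq_pred k) _.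
  pose j := Ordinal jn.
  have jF : j \in free_steps.
    rewrite inE prednK // (ltnW km) /=; apply: contra ndeg => /exists_inP[A hA /eqP cA].
    rewrite /degenerate b1 N0 !eqxx; apply/exists_inP; exists A => //.
    by rewrite cA; apply/eqP; lia.
  have kj : k = j.+1 :> nat by rewrite /= prednK.
  apply: (@face_step_last (s * tperm j k)%g) => //; first exact: swap_adapted.
  rewrite permM permKV tpermR; apply: tbound_gt1 => //.
  by rewrite -kj ltn_ord.
have k1n : (k.+1 < n)%N by apply: leq_trans km1 rank_bound.
pose k1 := Ordinal k1n.
have lt : (tbound b k1 < tbound b k)%N by apply: tbound_decr.
exists (vtx s N), (vtx (s * tperm k k1)%g N), (T k - T k1); split.
- exact: vtx_in_face.
- by apply: vtx_in_face; apply: swap_adapted.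
- by rewrite subr_eq0 eqr_nat gtn_eqF.
- apply/rowP => i; rewrite !mxE km1 andbT permM.
  have [iN|_] := boolP (i \in N).
    have ge : (m <= s i)%N by rewrite -sN.
    have /negbTE -> : s i != k by apply: contraTneq ge => ->; rewrite -ltnNge.
    have /negbTE -> : s i != k.+1 :> nat by apply: contraTneq ge => ->; rewrite -ltnNge.
    by rewrite !subrr mulr0.
  case: tpermP => [->|->|/eqP/negbTE -> sk1].
  - have /negbTE -> : k != k.+1 :> nat by rewrite neq_ltn ltnSn.
    by rewrite eqxx subr0 mulr1.
  - have /negbTE -> : k1 != k by rewrite -[k1 == k]/(k.+1 == k) neq_ltn ltnSn orbT.
    by rewrite /= eqxx sub0r mulrN1 opprB.
  - have /negbTE -> : s i != k.+1 :> nat by apply/eqP => E; apply: sk1; apply: val_inj.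
    by rewrite !subrr mulr0.
Qed.

(** Differences of points of the face have zero partial sums at the sizes in C, so free steps span
    them; each free step is a multiple of such a difference by [face_step], and the dual functionals
    give independence. *)
Lemma has_dim_face : has_dim (face N C) #|free_steps|.
Proof.
pose X := [tuple step (enum_val e) | e < #|free_steps|].
have XE (j : 'I_#|free_steps|) : X`_j = step (enum_val j) by rewrite -tnth_nth tnth_mktuple.
have [x0 x0F] : exists x, face N C x by exists (vtx s N); apply: vtx_in_face.
have inF (j : 'I_#|free_steps|) : enum_val j \in free_steps := enum_valP j.
have inm (j : 'I_#|free_steps|) : (enum_val j < m)%N.
  by have := inF j; rewrite inE => /andP[].
have dirU p : face N C p -> p - x0 \in <<X>>%VS.
  move=> [_ [pN pC]]; case: x0F => _ [x0N x0C].
  rewrite (step_expand (x := p - x0)) => [|i iN]; last by rewrite !mxE pN // x0N // subrr.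
  apply: memv_suml => k km; have [kC|kC] := boolP [exists A in C, #|A| == k.+1].
    case/exists_inP: kC => A hA /eqP cA.
    by rewrite -cA psumB -!psum_set // pC // x0C // subrr scale0r mem0v.
  have kF : k \in free_steps by rewrite inE km.
  apply/memvZ/memv_span/tnthP; exists (enum_rank_in kF k).
  by rewrite tnth_mktuple enum_rankK_in.
exists x0, <<X>>%VS; split; last first.
  rewrite -[RHS](size_tuple X); apply/eqP; apply/freeP => a a0 j.
  have := congr1 (psum (enum_val j).+1) a0; rewrite psum_sum.
  under eq_bigr do rewrite XE psumZ psum_step //.
  rewrite (bigD1 j) //= eqxx mulr1 big1 ?addr0 => [->|i ij].
    by rewrite /psum big1 // => i _; rewrite mxE.
  by rewrite (inj_eq enum_val_inj) eq_sym (negbTE ij) mulr0.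
apply/seteqP; split=> [y [d [c [r [rF c1 ->]]]]|_ [w wU <-]].
  exists (\sum_i c i *: (r i - x0)); first by apply: memv_suml => i _; apply/memvZ/dirU.
  under eq_bigr do rewrite scalerBr.
  by rewrite sumrB -scaler_suml c1 scale1r addrC subrK.
have {}wU : w \in <<X>>%VS := wU.
rewrite (coord_span wU); elim/big_rec: _ => [|j z _ IH].
  by rewrite addr0; apply: mem_affine_hull.
have [p [q [a [pF qF a0 pq]]]] := face_step (inF j).
rewrite XE addrCA addrC; have -> : step (enum_val j) = a^-1 *: (p - q).
  by rewrite pq scalerA mulVf // scale1r.
by rewrite scalerA; apply: affine_hull_shift.
Qed.

(** If i were outside N, all free steps would vanish at i and its bound would be 1. That puts i at
    the last rank with b_1 = 1 and N empty; by nondegeneracy the preceding step is free, yet it has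
    entry -1 at i. *)
Lemma face_coord_const i : (forall x, face N C x -> x ord0 i = 1) -> i \in N.
Proof.
move=> i1; apply: contraT; rewrite sN -ltnNge -/m => im.
have noF k : k \in free_steps -> step k ord0 i = 0.
  move=> /face_step[p [q [a [pF qF a0 /rowP/(_ i)]]]]; rewrite !mxE !i1 // subrr.
  by move/esym/eqP; rewrite mulf_eq0 (negbTE a0) => /eqP.
have T1 : (tbound b (s i) <= 1)%N.
  have := i1 _ (vtx_in_face sC); rewrite mxE sN leqNgt -/m im /= => /eqP.
  by rewrite pnatr_eq1 => /eqP ->.
have [b1 kn] : nth 0%N b 0 = 1%N /\ (s i).+1 = n.
  have := @tbound_gt1 _ _ b_gt0 (s i); rewrite [(1 < _)%N]ltnNge T1.
  by have := ltn_ord (s i); case: (nth 0%N b 0 =P 1%N) => // b1; lia.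
have mn : m = n by apply/eqP; rewrite eqn_leq rank_bound -kn.
have N0 : N = set0.
  have := cardsC N; rewrite card_ord -/m mn => cN; apply: cards0_eq.
  by move: cN; move: #|N| => c; lia.
have k0 : (0 < s i)%N.
  by rewrite lt0n; apply/eqP => k0; apply: nontriv; split=> //; rewrite -kn k0.
have jn : ((s i).-1 < n)%N by apply: leq_ltn_trans (leq_pred _) _.
have /noF : Ordinal jn \in free_steps.
  rewrite inE prednK // (ltnW im) /=; apply: contra ndeg => /exists_inP[A hA /eqP cA].
  rewrite /degenerate b1 N0 !eqxx; apply/exists_inP; exists A => //.
  by rewrite cA; apply/eqP; lia.
rewrite mxE /= prednK // eqxx im /=.
have /negbTE -> : s i != Ordinal jn.
  by rewrite -[s i == _]/(nat_of_ord (s i) == (s i).-1) neq_ltn prednK // leqnn orbT.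
by move/eqP; rewrite sub0r oppr_eq0 oner_eq0.
Qed.

(** The point [vtx s N] forces A to be an initial segment of ranks. If no member of C had its size,
    a free step would change the sum over A. *)
Lemma face_sum_const A : A != set0 -> A \subset ~: N ->
  (forall x, face N C x -> \sum_(i in A) x ord0 i = g #|A|) -> A \in C.
Proof.
move=> A0 AN A1; have := A1 _ (vtx_in_face sC).
rewrite (eq_bigr (fun i => (tbound b (s i))%:R)) => [|i iA]; last first.
  by rewrite mxE; have := subsetP AN i iA; rewrite inE => /negbTE ->.
rewrite -natr_sum => /eqP; rewrite eqr_nat top_sum_perm_eq // => /forallP sA.
have Agt : (0 < #|A|)%N by rewrite card_gt0.
have Am : (#|A| <= m)%N by apply: subset_leq_card.
have kn : (#|A|.-1 < n)%N by rewrite prednK // (leq_trans Am) // rank_bound.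
have [kF|] := boolP (Ordinal kn \in free_steps).
  have [p [q [a [pF qF a0 pq]]]] := face_step kF.
  have pE x : \sum_(i in A) x ord0 i = psum #|A| x.
    by apply: eq_bigl => i; apply/eqP/sA.
  have := psumB #|A| p q; rewrite -(pE p) -(pE q) !A1 // subrr pq psumZ.
  rewrite -{1}(prednK Agt) -[_.-1.+1]/(Ordinal kn).+1 psum_step ?eqxx ?mulr1 //=; last 2 first.
  - by rewrite prednK.
  - by rewrite prednK.
  by move=> a00; rewrite a00 eqxx in a0.
rewrite inE /= prednK // Am /= negbK => /exists_inP[B hB /eqP cB].
suff -> : A = B by [].
by apply/setP => i; rewrite (eqP (sA i)) sC // cB.
Qed.

End Direction.

(** * Correspondence between nondegenerate pairs and nonempty faces *)

Hypothesis nontriv : ~ (n = 1%N /\ nth 0%N b 0 = 1%N).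

Definition face_data (D : {set 'I_n} * {set {set 'I_n}}) :=
  (D.2 \in flags (~: D.1)) && ~~ degenerate D.1 D.2.

Definition data_dim (D : {set 'I_n} * {set {set 'I_n}}) := (n - #|D.1| - #|D.2|)%N.

Lemma has_dim_face_data D : face_data D -> has_dim (face D.1 D.2) (data_dim D).
Proof.
move=> /andP[CN nd]; have [s [sC sN]] := chain_rankC CN.
by rewrite /data_dim -(card_free_steps CN); apply: (has_dim_face CN sC sN).
Qed.

Lemma face_data_inj D D' : face_data D -> face_data D' ->
  face D.1 D.2 = face D'.1 D'.2 -> D = D'.
Proof.
have sub (N N' : {set 'I_n}) C C' : face_data (N, C) -> face N C = face N' C' -> N' \subset N.
  move=> /andP[CN nd] E; have [s [sC sN]] := chain_rankC CN.
  apply/subsetP => i iN'; apply: (face_coord_const CN sC sN) => // x.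
  by rewrite E => -[_ [-> ]].
have subC N C C' : face_data (N, C) -> face_data (N, C') -> face N C = face N C' -> C' \subset C.
  move=> /andP[CN nd] /andP[/flagsP[_ hC'] _] E; have [s [sC sN]] := chain_rankC CN.
  apply/subsetP => A hA; have [A0 AN] := hC' A hA.
  apply: (face_sum_const CN sC sN) => // x.
  by rewrite E => -[_ [_ ->]].
case: D D' => N C [N' C'] gD gD' /= E.
have NN : N = N'.
  by apply/eqP; rewrite eqEsubset (sub _ _ _ _ gD' (esym E)) (sub _ _ _ _ gD E).
subst N'; congr (_, _); apply/eqP.
by rewrite eqEsubset (subC _ _ _ gD gD' E) (subC _ _ _ gD' gD (esym E)).
Qed.

Lemma gbound_pred i : nth 0%N b 0 = 1%N -> g n = g n.-1 + 1.
Proof.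
move=> b1; have n0 : (0 < n)%N by apply: leq_ltn_trans (ltn_ord i).
rewrite /g -[1]/(1%:R) -natrD; congr (_%:R).
have kn : (n.-1 < n)%N by rewrite prednK.
rewrite /gbound (bigD1 (Ordinal kn)) //= addnC tbound_last ?b1 //= ?prednK //; congr (_ + _)%N.
apply: eq_bigl => j; rewrite ltn_ord /= -[j == _]/(nat_of_ord j == n.-1).
by have := ltn_ord j; case: ltngtP => //; lia.
Qed.

(* When b_1 = 1, the condition x(S) = g(n-1) on the complement S of i forces x_i = 1. *)
Lemma degenerate_face N C : C \in flags (~: N) -> degenerate N C ->
  exists N' C', face_data (N', C') /\ face N C = face N' C'.
Proof.
move=> CN /and3P[/eqP b1 /eqP N0 /exists_inP[A hA /eqP cA]]; subst N.
have /flagsP[/chainP cC hC] := CN.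
have A0 : (0 < #|A|)%N by rewrite card_gt0; case: (hC A hA).
have /cards1P[i iE] : #|~: A| == 1%N.
  by have := cardsC A; rewrite card_ord cA; move: A0; rewrite cA; move: #|_| => c; lia.
have AE : A = [set~ i] by rewrite -iE setCK.
have sumT x : \sum_(j in [set: 'I_n]) x ord0 j = x ord0 i + \sum_(j in A) x ord0 j.
  rewrite (bigD1 i) ?inE //=; congr (_ + _); apply: eq_bigl => j.
  by rewrite AE !inE.
(* The full set must leave the chain, as it is not inside [~: [set i]]; its equation follows from
   x_i = 1 and the one for A. *)
exists [set i], (C :\ [set: 'I_n]); split.
  apply/andP; split => /=; last first.
    rewrite /degenerate b1 eqxx /= negb_and; apply/orP; left.
    by apply/set0Pn; exists i; rewrite inE.
  apply/flagsP; split; first by apply: chain_sub (subsetDl _ _) _; apply/chainP.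
  move=> B /setD1P[BT hB]; split; first by case: (hC B hB).
  rewrite -AE; case/orP: (cC _ _ hA hB) => // sAB; apply: contraNT BT => nBA.
  rewrite eqEcard subsetT cardsT card_ord.
  by have := proper_card (A := A) (B := B); rewrite properE sAB nBA cA => /(_ isT); lia.
apply/seteqP; split=> x [Px [xN xC]]; split=> //; split.
- move=> j /set1P ->; apply/eqP; rewrite eq_le polytope_ge1 // andbT.
  have := polytope_sum_le [set: 'I_n] Px.
  by rewrite sumT xC // cardsT card_ord (gbound_pred i b1) cA addrC lerD2l.
- by move=> B /setD1P[_ hB]; apply: xC.
- by move=> j; rewrite inE.
- move=> B hB; have [->|BT] := eqVneq B [set: 'I_n]; last by apply: xC; rewrite !inE BT.
  have AT : A != [set: 'I_n] by rewrite AE -subTset; apply/subsetPn; exists i; rewrite !inE ?eqxx.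
  rewrite sumT xN ?inE // xC; last by rewrite !inE AT.
  by rewrite cardsT card_ord (gbound_pred i b1) cA addrC.
Qed.

(** A face with a dimension is nonempty, so it comes from a pair, which can be replaced by a
    nondegenerate one; that pair is unique. *)
Lemma f_vec_face_data d : f_vec P d = #|[set D | face_data D & data_dim D == d]|.
Proof.
set Ds := [set D | _ & _].
pose Fs : {fset set 'rV[R]_n} := [fset face D.1 D.2 | D in Ds]%fset.
rewrite /f_vec; have -> : [set F | is_face P F /\ has_dim F d]%classic = [set` Fs]%classic.
  apply/seteqP; split=> F /=; last first.
    move=> /imfsetP[D /= DD ->]; move: DD; rewrite inE => /andP[gD /eqP <-].
    by split; [apply: face_is_face|apply: has_dim_face_data].
  move=> [Ff Fd]; have [N [C [CN FE]]] := is_face_face Ff (has_dim_nonempty Fd).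
  have [N' [C' [gD E]]] : exists N' C', face_data (N', C') /\ face N C = face N' C'.
    have [dg|nd] := boolP (degenerate N C); first exact: degenerate_face.
    by exists N, C; split=> //; apply/andP.
  apply/imfsetP; exists (N', C'); rewrite ?FE //= inE gD /=; apply/eqP.
  by apply: has_dim_uniq (has_dim_face_data gD) _; rewrite /= -E -FE.
rewrite set_fsetK card_in_imfset /= => [|D D' /=]; first by rewrite -cardE.
by rewrite !inE => /andP[gD _] /andP[gD' _]; apply: face_data_inj.
Qed.

End ParkingPolytope.

(** * Assembling the h-polynomial *)

Section HPolynomial.
Variables (R : realType) (n : nat) (b : n.-tuple nat).
Hypothesis b_gt0 : forall i : 'I_n, (0 < tnth b i)%N.
Hypothesis nontriv : ~ (n = 1%N /\ nth 0%N b 0 = 1%N).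
Local Open Scope ring_scope.

Lemma h_poly_face_data :
  h_poly (parking_polytope R b) = \sum_(D | face_data b D) ('X - 1) ^+ data_dim D.
Proof.
have lt (D : {set 'I_n} * {set {set 'I_n}}) : (data_dim D < n.+1)%N.
  by rewrite ltnS /data_dim -subnDA leq_subr.
rewrite /h_poly /f_poly poly_def linear_sum /=.
rewrite (partition_big (fun D => Ordinal (lt D)) predT) //=.
apply: eq_bigr => d _; rewrite linearZ /= comp_Xn_poly (f_vec_face_data R b_gt0 nontriv).
rewrite (eq_bigr (fun=> ('X - 1) ^+ d)) => [|D /andP[_ /eqP <-] //].
rewrite sumr_const -natz scaler_nat; congr (_ *+ _).
by apply: eq_card => D; rewrite [LHS]inE.
Qed.

(** For b_1 = 1 the degenerate pairs, all with N empty, are removed from the sum over all pairs;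
    [nontriv] then ensures n > 1. *)
Lemma sum_face_data : (0 < n)%N ->
  \sum_(D | face_data b D) ('X - 1) ^+ data_dim D =
    if nth 0%N b 0 == 1%N
    then binomial_eulerian n - ('X * eulerian n.-1) *+ n
    else binomial_eulerian n.
Proof.
move=> n_gt0; rewrite -(sum_data n).
rewrite [X in _ = if _ then X - _ else _](bigID (fun D => degenerate b D.1 D.2)) /=.
rewrite /face_data; case: ifP => b1; last first.
  by apply: eq_bigl => D; rewrite /degenerate b1 andbT.
rewrite -sum_degenerate_data; last first.
  rewrite ltn_neqAle n_gt0 andbT; apply/eqP => n1; apply: nontriv.
  by split; [rewrite -n1|apply/eqP].
set S1 := \sum_(C in _ | _) _; suff -> : \sum_(D | (D.2 \in flags (~: D.1)) && degenerate b D.1 D.2)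
   ('X - 1) ^+ (n - #|D.1| - #|D.2|) = S1 by rewrite addrAC subrr add0r.
rewrite (eq_bigl (fun D => pred1 set0 D.1 &&
    ((D.2 \in flags (~: D.1)) && [exists A in D.2, #|A| == n.-1]))).
  rewrite -(pair_big_dep (pred1 set0)
     (fun N C => (C \in flags (~: N)) && [exists A in C, #|A| == n.-1])
     (fun N C => ('X - 1) ^+ (n - #|N| - #|C|))) /=.
  by rewrite big_pred1_eq setC0 cards0 subn0.
by move=> D; rewrite /degenerate b1 /= andbCA.
Qed.

End HPolynomial.

Theorem theorem2p15 (R : realType) (n : nat) (b : n.-tuple nat)
    (n_gt0 : (0 < n)%N) (b_gt0 : forall i : 'I_n, (0 < tnth b i)%N)
    (nontriv : ~ (n = 1%N /\ nth 0%N b 0 = 1%N)) :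
  h_poly (parking_polytope R b) =
    if nth 0%N b 0 == 1%N
    then binomial_eulerian n - ('X * eulerian n.-1) *+ n
    else binomial_eulerian n.
Proof. by rewrite h_poly_face_data // sum_face_data. Qed.
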